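(* Let $n\ge 2$, let $\Omega\subset\mathbb{R}^n$ be a ball, and let $V:\mathbb{R}^n\to\mathbb{R}^n$ be a smooth vector field such that $\operatorname{div}V=0$. For $t\in\mathbb{R}$ with $|t|$ small, let $T_t(x)=x+tV(x)$ and $\Omega_t=T_t(\Omega)$. Then the map $t\mapsto\lambda_{1,\Omega_t}$ is differentiable at $t=0$ and $$\frac{d}{dt}\lambda_{1,\Omega_t}\Big|_{t=0}=0.$$
   Context: For a smooth bounded open set $\Omega\subset\mathbb{R}^n$, the first eigenvalue of the $1$-Laplacian on $\Omega$ is $$\lambda_{1,\Omega}=\inf\Big\{\int_\Omega|\nabla u|\,dx : u\in \dot H_1^1(\Omega),\ \int_\Omega|u|\,dx=1\Big\},$$ where $\dot H_1^1(\Omega)$ is the closure of $C_0^\infty(\Omega)$ in the Sobolev space $H^1_1(\Omega)$ of functions in $L^1(\Omega)$ with one derivative in $L^1(\Omega)$. Equivalently, $$\lambda_{1,\Omega}=\inf\Big\{\frac{|\partial C|}{|C|} : C\subset\overline{\Omega},\ \chi_C\in BV(\mathbb{R}^n),\ |C|>0\Big\},$$ where $\chi_C$ is the characteristic function of $C$, $|C|$ is its Lebesgue measure, and $|\partial C|=\int_{\mathbb{R}^n}|\nabla\chi_C|$ is its perimeter (total variation of $\nabla\chi_C$). The maps $T_t$ are regarded as diffeomorphisms for $|t|$ small. *)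

(* Defs.v *)
From HB Require Import structures.
From mathcomp Require Import all_boot all_order all_algebra.
From mathcomp Require Import all_classical all_reals all_analysis.

Set Implicit Arguments.
Unset Strict Implicit.
Unset Printing Implicit Defensive.

Import Order.TTheory GRing.Theory Num.Theory.
Import numFieldNormedType.Exports.

Local Open Scope classical_set_scope.
Local Open Scope ring_scope.

(* R^n is 'rV[R]_n.  The library norm on it is the sup norm; it induces the
   usual topology and notion of differentiability, but lengths in the
   definitions below are always Euclidean. *)

Definition rV_display : measure_display.
Proof. exact. Qed.

Definition coord (R : realType) (n : nat) (i : 'I_n) (x : 'rV[R]_n) : R :=
  x ord0 i.

(* The product of n copies of the Borel sigma-algebra of R. *)
Definition measurable_rV (R : realType) (n : nat) : set (set 'rV[R]_n) :=
  g_sigma_preimage (@coord R n).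

Lemma measurable_rV0 (R : realType) n : @measurable_rV R n set0.
Proof. exact: sigma_algebra0. Qed.

Lemma measurable_rVC (R : realType) n (A : set 'rV[R]_n) :
  measurable_rV A -> measurable_rV (~` A).
Proof. exact: sigma_algebraC. Qed.

Lemma measurable_rV_bigcup (R : realType) n (F : (set 'rV[R]_n)^nat) :
  (forall i, measurable_rV (F i)) -> measurable_rV (\bigcup_i F i).
Proof. exact: sigma_algebra_bigcup. Qed.

HB.instance Definition _ (R : realType) n :=
  @isMeasurable.Build rV_display 'rV[R]_n
    (@measurable_rV R n) (@measurable_rV0 R n) (@measurable_rVC R n)
    (@measurable_rV_bigcup R n).

Lemma measurable_coord (R : realType) n (i : 'I_n) :
  measurable_fun [set: 'rV[R]_n] (coord i).
Proof.
move=> _ Y mY; rewrite setTI; apply: sub_sigma_algebra => /=.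
rewrite -bigcup_seq/=; exists i => /=; first by rewrite mem_index_enum.
by exists Y => //; rewrite setTI.
Qed.

Lemma measurable_fun_coordP d (T : measurableType d) (R : realType) n
    (f : T -> 'rV[R]_n) :
  (forall i, measurable_fun [set: T] (fun x => coord i (f x))) ->
  measurable_fun [set: T] f.
Proof.
move=> mf.
have mS : @measurable_rV R n `<=` [set A | measurable (f @^-1` A)].
  apply: smallest_sub.
    split => [|A mA|F mF].
    - by rewrite /= preimage_set0; exact: measurable0.
    - by rewrite /= setTD preimage_setC; exact: measurableC.
    - rewrite /= preimage_bigcup; apply: bigcupT_measurable => k; exact: mF.
  move=> A; rewrite -bigcup_seq/= => -[i _ [B mB <-]].
  by rewrite /= setTI -[X in measurable X]setTI; exact: mf.
by move=> _ A mA; rewrite setTI; exact: mS.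
Qed.

Definition cons_rV (R : realType) n (p : measurableTypeR R * 'rV[R]_n) :
    'rV[R]_n.+1 :=
  row_mx (p.1)%:M p.2.

Definition uncons_rV (R : realType) n (x : 'rV[R]_n.+1) :
    measurableTypeR R * 'rV[R]_n :=
  (x ord0 ord0, \row_i x ord0 (lift ord0 i)).

Lemma cons_rV0 (R : realType) n (p : measurableTypeR R * 'rV[R]_n) :
  cons_rV p ord0 ord0 = p.1.
Proof.
transitivity (row_mx (p.1)%:M p.2 ord0 (lshift n ord0)).
  by congr (row_mx _ _ _ _); exact: val_inj.
by rewrite row_mxEl mxE eqxx mulr1n.
Qed.

Lemma cons_rVS (R : realType) n (p : measurableTypeR R * 'rV[R]_n) i :
  cons_rV p ord0 (lift ord0 i) = p.2 ord0 i.
Proof.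
transitivity (row_mx (p.1)%:M p.2 ord0 (rshift 1 i)).
  by congr (row_mx _ _ _ _); exact: val_inj.
by rewrite row_mxEr.
Qed.

Lemma cons_rVK (R : realType) n : cancel (@cons_rV R n) (@uncons_rV R n).
Proof.
move=> [a x]; rewrite /uncons_rV cons_rV0/=; congr pair.
by apply/rowP => i; rewrite mxE cons_rVS.
Qed.

Lemma uncons_rVK (R : realType) n : cancel (@uncons_rV R n) (@cons_rV R n).
Proof.
move=> x; apply/rowP => i; case: (unliftP ord0 i) => [j|] ->.
  by rewrite cons_rVS mxE.
by rewrite cons_rV0.
Qed.

Lemma measurable_cons_rV (R : realType) n :
  measurable_fun [set: measurableTypeR R * 'rV[R]_n] (@cons_rV R n).
Proof.
apply: measurable_fun_coordP => i; rewrite /coord.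
case: (unliftP ord0 i) => [j|] ->.
  under eq_fun do rewrite cons_rVS.
  apply: (measurableT_comp (@measurable_coord R n j)).
  exact: measurable_snd.
under eq_fun do rewrite cons_rV0.
exact: measurable_fst.
Qed.

Lemma measurable_uncons_rV (R : realType) n :
  measurable_fun [set: 'rV[R]_n.+1] (@uncons_rV R n).
Proof.
apply/measurable_fun_pairP; split; first exact: (measurable_coord ord0).
apply: measurable_fun_coordP => i; rewrite /coord/=.
under eq_fun do rewrite mxE.
exact: (measurable_coord (lift ord0 i)).
Qed.

Definition lebesgue_rVS (R : realType) n
    (m : {sigma_finite_measure set 'rV[R]_n -> \bar R}) :
    set 'rV[R]_n.+1 -> \bar R :=
  pushforward ((@lebesgue_measure R \x m)%E) (@cons_rV R n).

Lemma lebesgue_rVS0 (R : realType) n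
    (m : {sigma_finite_measure set 'rV[R]_n -> \bar R}) :
  lebesgue_rVS m set0 = 0%E.
Proof. by rewrite /lebesgue_rVS /pushforward preimage_set0 measure0. Qed.

Lemma lebesgue_rVS_ge0 (R : realType) n
    (m : {sigma_finite_measure set 'rV[R]_n -> \bar R}) A :
  (0 <= lebesgue_rVS m A)%E.
Proof. by rewrite /lebesgue_rVS /pushforward; exact: measure_ge0. Qed.

Lemma lebesgue_rVS_sigma_additive (R : realType) n
    (m : {sigma_finite_measure set 'rV[R]_n -> \bar R}) :
  semi_sigma_additive (lebesgue_rVS m).
Proof.
move=> F mF tF mUF; rewrite /lebesgue_rVS /pushforward preimage_bigcup.
apply: measure_semi_sigma_additive.
- by move=> k; rewrite -[X in measurable X]setTI; exact: measurable_cons_rV.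
- apply/trivIsetP => /= i j _ _ ij; rewrite -preimage_setI.
  by move/trivIsetP : tF => /(_ _ _ _ _ ij) ->//; rewrite preimage_set0.
- rewrite -preimage_bigcup -[X in measurable X]setTI.
  exact: measurable_cons_rV.
Qed.

HB.instance Definition _ (R : realType) n
    (m : {sigma_finite_measure set 'rV[R]_n -> \bar R}) :=
  isMeasure.Build _ _ _ (lebesgue_rVS m)
    (lebesgue_rVS0 m) (lebesgue_rVS_ge0 m) (@lebesgue_rVS_sigma_additive R n m).

Lemma lebesgue_rVS_sigma_finite (R : realType) n
    (m : {sigma_finite_measure set 'rV[R]_n -> \bar R}) :
  sigma_finite setT (lebesgue_rVS m).
Proof.
have /sigma_finiteP[F [TF ndF Foo]] := sigma_finiteT (@lebesgue_measure R).
have /sigma_finiteP[G [TG ndG Goo]] := sigma_finiteT m.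
exists (fun k => @uncons_rV R n @^-1` (F k `*` G k)).
  rewrite -preimage_bigcup [X in _ @^-1` X](_ : _ = setT) ?preimage_setT//.
  rewrite -subTset => -[x y] _.
  have [i _ Fix] : (\bigcup_k F k) x by rewrite -TF.
  have [j _ Gjy] : (\bigcup_k G k) y by rewrite -TG.
  exists (maxn i j) => //; split => /=.
    by move: x Fix; exact/subsetPset/ndF/leq_maxl.
  by move: y Gjy; exact/subsetPset/ndG/leq_maxr.
move=> k; have [mFk Fk] := Foo k; have [mGk Gk] := Goo k.
have mFG : measurable (F k `*` G k) by exact: measurableX.
split.
  by rewrite -[X in measurable X]setTI; exact: measurable_uncons_rV.
rewrite /lebesgue_rVS /pushforward -comp_preimage.
rewrite (_ : _ \o _ = id); last by apply/funext => p /=; rewrite cons_rVK.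
by rewrite preimage_id product_measure1E// lte_mul_pinfty// ge0_fin_numE.
Qed.

HB.instance Definition _ (R : realType) n
    (m : {sigma_finite_measure set 'rV[R]_n -> \bar R}) :=
  @Measure_isSigmaFinite.Build _ _ _ (lebesgue_rVS m)
    (lebesgue_rVS_sigma_finite m).

(* n-dimensional Lebesgue measure: the n-fold product of the one-dimensional
   one (a point mass for n = 0). *)
Fixpoint lebesgue_rV (R : realType) (n : nat) :
    {sigma_finite_measure set 'rV[R]_n -> \bar R} :=
  match n with
  | 0 => dirac (0 : 'rV[R]_0)
  | n'.+1 => lebesgue_rVS (lebesgue_rV R n')
  end.

Definition enorm (R : realType) n (x : 'rV[R]_n) : R :=
  Num.sqrt (\sum_i x ord0 i ^+ 2).

Definition eball (R : realType) n (a : 'rV[R]_n) (r : R) : set 'rV[R]_n :=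
  [set x | enorm (x - a) < r].

Definition partial (R : realType) n (i : 'I_n) (f : 'rV[R]_n -> R) :
    'rV[R]_n -> R :=
  fun x => 'D_(delta_mx ord0 i) f x.

Definition grad (R : realType) n (f : 'rV[R]_n -> R) (x : 'rV[R]_n) :
    'rV[R]_n :=
  \row_i partial i f x.

(* C^oo: every iterated partial derivative (including f itself) is
   differentiable everywhere. *)
Definition smooth (R : realType) n (f : 'rV[R]_n -> R) : Prop :=
  forall (s : seq 'I_n) (x : 'rV[R]_n),
    differentiable (foldr (@partial R n) f s) x.

Definition smooth_field (R : realType) n (V : 'rV[R]_n -> 'rV[R]_n) : Prop :=
  forall i, smooth (fun x => V x ord0 i).

Definition divergence (R : realType) n (V : 'rV[R]_n -> 'rV[R]_n)
    (x : 'rV[R]_n) : R :=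
  \sum_i partial i (fun y => V y ord0 i) x.

Definition test_function (R : realType) n (Omega : set 'rV[R]_n)
    (phi : 'rV[R]_n -> R) : Prop :=
  let supp := closure [set x | phi x != 0] in
  [/\ smooth phi, compact supp & supp `<=` Omega].

Definition weak_gradient (R : realType) n (Omega : set 'rV[R]_n)
    (u : 'rV[R]_n -> R) (g : 'rV[R]_n -> 'rV[R]_n) : Prop :=
  forall phi, test_function Omega phi -> forall i,
    \int[lebesgue_rV R n]_(x in Omega) (u x * partial i phi x) =
    - \int[lebesgue_rV R n]_(x in Omega) (g x ord0 i * phi x).

(* Elements of H^1_1(Omega) are handled as pairs of a function and (a
   representative of) its weak gradient; values outside Omega are irrelevant. *)
Definition sobolev11 (R : realType) n (Omega : set 'rV[R]_n)
    (u : 'rV[R]_n -> R) (g : 'rV[R]_n -> 'rV[R]_n) : Prop :=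
  [/\ (lebesgue_rV R n).-integrable Omega (EFin \o u),
      forall i, (lebesgue_rV R n).-integrable Omega
                  (EFin \o (fun x => g x ord0 i))
    & weak_gradient Omega u g].

Definition sobolev11_norm (R : realType) n (Omega : set 'rV[R]_n)
    (u : 'rV[R]_n -> R) (g : 'rV[R]_n -> 'rV[R]_n) : R :=
  \int[lebesgue_rV R n]_(x in Omega) `|u x| +
  \int[lebesgue_rV R n]_(x in Omega) enorm (g x).

(* The closure of the test functions in H^1_1(Omega). *)
Definition sobolev11_0 (R : realType) n (Omega : set 'rV[R]_n)
    (u : 'rV[R]_n -> R) (g : 'rV[R]_n -> 'rV[R]_n) : Prop :=
  sobolev11 Omega u g /\
  forall e : R, 0 < e -> exists2 phi, test_function Omega phi &
    sobolev11_norm Omega (fun x => u x - phi x) (fun x => g x - grad phi x) < e.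

Definition lambda1 (R : realType) n (Omega : set 'rV[R]_n) : R :=
  inf [set l | exists u g, [/\ sobolev11_0 Omega u g,
    \int[lebesgue_rV R n]_(x in Omega) `|u x| = 1 &
    l = \int[lebesgue_rV R n]_(x in Omega) enorm (g x)]].

Definition perturbation (R : realType) n (V : 'rV[R]_n -> 'rV[R]_n) (t : R)
    (x : 'rV[R]_n) : 'rV[R]_n :=
  x + t *: V x.

(* Main.v *)
From HB Require Import structures.
Require Import Defs.
From mathcomp Require Import all_boot all_order all_algebra.
From mathcomp Require Import all_classical all_reals all_analysis.
From mathcomp Require Import measurable_realfun.
From mathcomp Require Import ring lra.

Set Implicit Arguments.
Unset Strict Implicit.
Unset Printing Implicit Defensive.

Import Order.TTheory GRing.Theory Num.Theory.
Import numFieldNormedType.Exports.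

Local Open Scope classical_set_scope.
Local Open Scope ring_scope.

(** For small t, the field S y = y - a - t V y (radial_field) is, up to O(t^2),
    the position relative to the centre a of the point that the perturbation
    x |-> x + t V x sends to y.  Its divergence is exactly n, because
    div V = 0.  The same field S calibrates the perturbed ball Omega_t from
    both sides.

    Lower bound.  At y = x + t V x, S y = x - a + t (V x - V y) and
    V x - V y = O(t), so that |S| <= r + O(t^2) on Omega_t: the first-order
    terms cancel.  The divergence theorem for the field S and the function
    |phi|, made C1, gives
    n int |phi| <= (r + O(t^2)) int |grad phi| for each test function phi
    (calibration_lower_bound).

    Upper bound.  A smooth decreasing function v of |S|^2 that is constant for
    |S| <= r - 2 delta and 0 for |S| >= r - delta, with delta = O(t^2), is a
    test function on Omega_t (test_function_boundary_layer).  The vector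
    - grad v makes an angle O(t) with S, of cosine 1 - O(t^2)
    (angle_bound), so that |grad v| is at most (1 + O(t^2)) / (r - 2 delta)
    times - S . grad v, whose integral is n int v
    (calibration_upper_bound).

    Hence the eigenvalue is n / r + O(t^2) (lambda1_perturbation_quadratic),
    and its derivative at 0 vanishes. *)

(** * Borel sets and cubes *)

Lemma ball_rVE (R : realType) n (a y : 'rV[R]_n) (e : R) : 0 < e ->
  ball a e y <-> forall i, `|a ord0 i - y ord0 i| < e.
Proof.
move=> e0; split => [[_ h] i|h]; first by have := h ord0 i.
by split => // i j; rewrite (ord1 i); exact: h.
Qed.

Lemma measurable_ball_rV (R : realType) n (a : 'rV[R]_n) (e : R) :
  measurable (ball a e).
Proof.
have [e0|e0] := ltP 0 e; last first.
  rewrite (_ : ball a e = set0)//; apply/seteqP; split => // y [].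
  by rewrite ltNge e0.
rewrite (_ : ball a e = \bigcap_i (@Defs.coord R n i @^-1` ball (a ord0 i) e)).
  apply: fin_bigcap_measurable => // i _.
  rewrite -[X in measurable X]setTI; apply: measurable_coord => //.
  exact: measurable_ball.
apply/seteqP; split => y.
  by move=> /(ball_rVE _ _ e0) h i _; exact: h.
by move=> h; apply/(ball_rVE _ _ e0) => i; exact: h.
Qed.

(** The balls with a rational centre and a radius 1 / (k + 1) form a countable
    base of the topology. *)
Lemma open_measurable_rV (R : realType) n (U : set 'rV[R]_n) :
  open U -> measurable U.
Proof.
move=> oU.
pose B (p : 'rV[rat]_n * nat) := ball (map_mx ratr p.1 : 'rV[R]_n) p.2.+1%:R^-1.
pose F p := if `[< B p `<=` U >] then B p else set0.
rewrite (_ : U = \bigcup_p F p).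
  apply: countable_bigcupT_measurable => [|p]; first exact: countableP.
  rewrite /F.
  by case: ifP => // _; exact: measurable_ball_rV.
apply/seteqP; split => x; last first.
  by move=> [p _]; rewrite /F; case: ifPn => // /asboolP; exact.
move=> Ux; have /nbhs_ballP[e /= e0 xeU] : nbhs x U by exact: open_nbhs_nbhs.
have [k _ /(_ k (leqnn _)) /=] := near_infty_natSinv_lt (PosNum (divr_gt0 e0 (ltr0n _ 2))).
move=> ke.
have k0 : 0 < k.+1%:R^-1 :> R by [].
have /choice[q qx] (i : 'I_n) : exists q : rat, `|ratr q - x ord0 i| < k.+1%:R^-1.
  have /rat_in_itvoo[q /itvP qx] : x ord0 i - k.+1%:R^-1 < x ord0 i + k.+1%:R^-1.
    by rewrite ltrBlDr -addrA ltrDl addr_gt0.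
  by exists q; rewrite ltr_distl !qx.
exists (\row_i q i, k) => //.
have Bx : B (\row_i q i, k) x.
  by apply/ball_rVE => // i; rewrite !mxE.
rewrite /F; case: ifPn => // /asboolP nB; exfalso; apply: nB => y By; apply: xeU.
apply: (@le_ball _ _ _ (k.+1%:R^-1 + k.+1%:R^-1)); first by rewrite (splitr e) lerD// ltW.
by apply: (ball_triangle (ball_sym Bx)).
Qed.

Lemma closed_measurable_rV (R : realType) n (U : set 'rV[R]_n) :
  closed U -> measurable U.
Proof.
move=> cU; rewrite -(setCK U); apply: measurableC.
by apply: open_measurable_rV; exact: closed_openC.
Qed.

Lemma continuous_measurable_rV (R : realType) n (f : 'rV[R]_n -> R) :
  continuous f -> measurable_fun setT f.
Proof.
move=> cf; apply: (measurability _ (RGenOpens.measurableE R)).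
move=> _ [_ [a [b ->] <-]]; rewrite setTI; apply: open_measurable_rV.
by move/continuousP : cf; apply; exact: interval_open.
Qed.

(** The ball of the sup norm is a cube. *)
Lemma lebesgue_rV_ball (R : realType) n (a : 'rV[R]_n) (e : R) : 0 < e ->
  lebesgue_rV R n (ball a e) = ((e *+ 2) ^+ n)%:E.
Proof.
move=> e0; elim: n a => [|n IH] a.
  rewrite /= diracE expr0 mem_set//.
  by apply/ball_rVE => // -[].
rewrite /= /lebesgue_rVS /pushforward.
rewrite (_ : _ @^-1` _ = ball (a ord0 ord0) e `*` ball (\row_i a ord0 (lift ord0 i)) e).
  rewrite product_measure1E; [|exact: measurable_ball|exact: measurable_ball_rV].
  by rewrite IH [X in (X * _)%E](lebesgue_measure_ball _ (ltW e0)) -EFinM exprS.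
apply/seteqP; split => -[x y] /=.
  move=> /(ball_rVE _ _ e0) h; split.
    by have := h ord0; rewrite cons_rV0.
  by apply/ball_rVE => // i; have := h (lift ord0 i); rewrite cons_rVS mxE.
move=> [hx /(ball_rVE _ _ e0) hy]; apply/ball_rVE => // i.
case: (unliftP ord0 i) => [j|] ->; first by have := hy j; rewrite cons_rVS mxE.
by rewrite cons_rV0.
Qed.

Lemma compact_closed_ball_rV (R : realType) n (a : 'rV[R]_n) (e : R) :
  compact (closed_ball_ Num.norm a e).
Proof.
apply: bounded_closed_compact; last exact: closed_closed_ball_.
exists (e + `|a|); split; first exact: num_real.
move=> M ltM x /= xa; apply: le_trans (ltW ltM).
by rewrite -[x in leLHS](subrK a) (le_trans (ler_normD _ _))// lerD2r distrC.
Qed.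

Lemma compact_ball_bounded (R : realType) n (a : 'rV[R]_n) (e : R)
  (f : 'rV[R]_n -> R) : continuous f ->
  exists2 M, 0 < M & forall x, `|a - x| <= e -> `|f x| <= M.
Proof.
move=> cf; have := @compact_closed_ball_rV R n a e.
move=> /(continuous_compact (continuous_subspaceT cf))/compact_bounded.
move=> [M [_ hM]]; exists (`|M| + 1) => [|x xa]; first by rewrite ltr_pwDr.
by apply: (hM (`|M| + 1)); [rewrite ltr_pwDr// ler_norm|exists x].
Qed.

Lemma integrable_continuous_compact_rV (R : realType) n (a : 'rV[R]_n) (e : R)
  (f : 'rV[R]_n -> R) : continuous f ->
  (forall x, f x != 0 -> ball a e x) ->
  (lebesgue_rV R n).-integrable setT (EFin \o f).
Proof.
move=> cf f0.
have [e0|e0] := ltP 0 e; last first.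
  rewrite (_ : _ \o _ = cst 0%E); first exact: integrable0.
  apply/funext => x/=; have [->//|/f0[]] := eqVneq (f x) 0.
  by rewrite ltNge e0.
have -> : EFin \o f = (EFin \o f) \_ (ball a e).
  apply/funext => x; rewrite patchE; case: ifPn => // /negP xa /=.
  by have [->//|/f0 xb] := eqVneq (f x) 0; exfalso; apply: xa; rewrite inE.
apply/(integrable_mkcond _ (measurable_ball_rV a e)).
apply: measurable_bounded_integrable.
- exact: measurable_ball_rV.
- by rewrite [X in (X < _)%E](lebesgue_rV_ball a e0) ltry.
- exact: (measurable_funS measurableT (@subsetT _ _) (continuous_measurable_rV cf)).
have [M M0 hM] := compact_ball_bounded a e cf.
exists M; split; first exact: num_real.
move=> N /ltW MN x /=; rewrite -ball_normE /= => /ltW/hM/le_trans; exact.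
Qed.

Lemma coord_le_norm (R : realType) n (x : 'rV[R]_n) i : `|x ord0 i| <= `|x|.
Proof.
by rewrite [leRHS]mx_normrE; apply: (le_bigmax _ (fun ij => `|x ij.1 ij.2|) (ord0, i)).
Qed.

(** * Integrals of partial derivatives *)

Section integral_cons.
Context {R : realType} {n : nat}.
Local Notation mu := (@lebesgue_measure R).
Local Notation m := (lebesgue_rV R n).
Local Open Scope ereal_scope.

Lemma integrable_cons_rV (f : 'rV[R]_n.+1 -> \bar R) :
  measurable_fun setT f -> (lebesgue_rV R n.+1).-integrable setT f ->
  (mu \x m).-integrable setT (f \o @cons_rV R n).
Proof.
move=> mf /integrableP[_ foo].
have mfc : measurable_fun setT (f \o @cons_rV R n).
  by apply: measurableT_comp => //; exact: measurable_cons_rV.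
apply/integrableP; split => //; apply: le_lt_trans foo.
rewrite (ge0_integral_pushforward (@measurable_cons_rV R n) _ measurableT)//.
by apply: measurableT_comp.
Qed.

Lemma integral_cons_rV (f : 'rV[R]_n.+1 -> \bar R) :
  measurable_fun setT f -> (lebesgue_rV R n.+1).-integrable setT f ->
  \int[lebesgue_rV R n.+1]_x f x = \int[mu \x m]_p f (cons_rV p).
Proof.
move=> mf /(integrable_cons_rV mf) intf.
exact: (integral_pushforward (@measurable_cons_rV R n) mf (D := setT)).
Qed.

End integral_cons.

Lemma cons_rVD (R : realType) n (s h : R) (x y : 'rV[R]_n) :
  cons_rV (s + h, x + y) = cons_rV (s, x) + cons_rV (h, y).
Proof.
apply/rowP => i; rewrite [RHS]mxE.
by case: (unliftP ord0 i) => [j|] ->; rewrite ?(cons_rVS, cons_rV0)/= ?mxE.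
Qed.

Lemma delta_mx0_cons (R : realType) n (h : R) :
  h *: delta_mx ord0 ord0 = cons_rV (h, 0 : 'rV[R]_n).
Proof.
apply/rowP => i; rewrite [LHS]mxE [delta_mx _ _ _ _]mxE.
by case: (unliftP ord0 i) => [j|] ->; rewrite ?(cons_rVS, cons_rV0)/= ?mxE ?mulr0 ?mulr1.
Qed.

Lemma delta_mxS_cons (R : realType) n (h : R) (j : 'I_n) :
  h *: delta_mx ord0 (lift ord0 j) = cons_rV (0, h *: delta_mx ord0 j).
Proof.
apply/rowP => i; rewrite [LHS]mxE [delta_mx _ _ _ _]mxE.
by case: (unliftP ord0 i) => [k|] ->; rewrite ?(cons_rVS, cons_rV0)/= ?mxE ?mulr0//
  (inj_eq lift_inj).
Qed.

(** Both derivatives are limits of one and the same difference quotient.  This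
    moves a directional derivative to the restriction of the function to a
    line or to a coordinate slice. *)
Lemma is_derive_line (R : realType) (U V W : normedModType R)
  (f : U -> W) (g : V -> W) u v (x y : _) df :
  (forall h : R, f (h *: u + x) = g (h *: v + y)) ->
  is_derive x u f df -> is_derive y v g df.
Proof.
move=> fg; have fgxy : f x = g y by have := fg 0; rewrite !scale0r !add0r.
have E : (fun h => h^-1 *: ((f \o shift x) (h *: u) - f x)) =
    (fun h => h^-1 *: ((g \o shift y) (h *: v) - g y)).
  by apply/funext => h; rewrite /= fg fgxy.
move=> [dx vx]; split; first by rewrite /derivable -E.
by rewrite -vx /derive -E.
Qed.

Lemma continuous_cons_rV2 (R : realType) n (s : R) :
  continuous (fun y : 'rV[R]_n => cons_rV (s, y)).
Proof.
move=> y A /nbhs_ballP[e /= e0 eA]; apply/nbhs_ballP; exists e => //= z.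
move=> /(ball_rVE _ _ e0) h.
apply: eA; apply/ball_rVE => // i.
case: (unliftP ord0 i) => [j|] ->; rewrite ?(cons_rVS, cons_rV0)//=.
by rewrite subrr normr0.
Qed.

Lemma continuous_cons_rV1 (R : realType) n (y : 'rV[R]_n) :
  continuous (fun s : R => cons_rV (s, y)).
Proof.
move=> s A /nbhs_ballP[e /= e0 eA]; apply/nbhs_ballP; exists e => //= z h.
apply: eA; apply/ball_rVE => // i.
case: (unliftP ord0 i) => [j|] ->; rewrite ?(cons_rVS, cons_rV0)//=.
by rewrite subrr normr0.
Qed.

Lemma integral_derive_compact (R : realType) (f g : R -> R) (M : R) : 0 < M ->
  continuous g -> (forall x : R, is_derive x (1 : R) f (g x)) ->
  (forall x, M <= `|x| -> f x = 0 /\ g x = 0) ->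
  (\int[@lebesgue_measure R]_x (g x)%:E = 0)%E.
Proof.
move=> M0 cg fg z.
have cf : continuous f.
  move=> x; apply: differentiable_continuous; apply/derivable1_diffP.
  by have [] := fg x.
transitivity (\int[@lebesgue_measure R]_(x in `[(- M)%R, M%R]) (g x)%:E)%E.
  rewrite [RHS]integral_mkcond; apply: eq_integral => x _.
  rewrite patchE mem_setE in_itv/= -ler_norml; case: ifPn => //; rewrite -ltNge.
  by move=> /ltW/z[_ ->].
rewrite (@continuous_FTC2 _ g f).
- have [-> _] := z M (ler_norm _).
  have [|-> _] := z (- M); last by rewrite subee.
  by rewrite normrN ler_norm.
- by lra.
- exact: continuous_subspaceT.
- split; [by move=> x _; have [] := fg x| |].
  + by apply: cvg_at_right_filter; exact: cf.
  + by apply: cvg_at_left_filter; exact: cf.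
- by move=> x _; rewrite derive1E; have [_ ->] := fg x.
Qed.

(** By Fubini and induction on the dimension: the first coordinate is split off,
    and it is the inner variable exactly when the derivative is along it.  The
    support is bounded coordinate by coordinate so that every slice inherits
    the hypothesis with the same M. *)
Lemma integral_partial_compact (R : realType) n (f g : 'rV[R]_n -> R)
    (i : 'I_n) (M : R) : 0 < M -> continuous g ->
  (forall x : 'rV[R]_n, is_derive x (delta_mx ord0 i) f (g x)) ->
  (forall x : 'rV[R]_n, (exists j, M <= `|x ord0 j|) -> f x = 0 /\ g x = 0) ->
  (\int[lebesgue_rV R n]_x (g x)%:E = 0)%E.
Proof.
move=> M0; elim: n => [|n IH] in f g i *; first by case: i.
move=> cg fg z.
have mg : measurable_fun setT (EFin \o g).
  by apply/measurable_EFinP; exact: continuous_measurable_rV.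
have ig : (lebesgue_rV R n.+1).-integrable setT (EFin \o g).
  apply: (@integrable_continuous_compact_rV _ _ 0 M) => // x gx0.
  apply/ball_rVE => // j; rewrite mxE sub0r normrN ltNge; apply/negP => Mx.
  by move/eqP : gx0; apply; have [] := z x (ex_intro _ j Mx).
have ic := integrable_cons_rV mg ig.
rewrite (integral_cons_rV mg ig).
case: (unliftP ord0 i) => [j|] ij; rewrite ij in fg.
- rewrite -(integral12_prod_meas1 ic) integral0_eq// => s _.
  apply: (IH (fun y => f (cons_rV (s, y))) (fun y => g (cons_rV (s, y))) j).
  + by move=> y; apply: continuous_comp; [exact: continuous_cons_rV2|exact: cg].
  + move=> y; apply: is_derive_line (fg _) => h.
    by rewrite delta_mxS_cons -cons_rVD add0r.
  + by move=> y [k Mk]; apply: z; exists (lift ord0 k); rewrite cons_rVS.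
- rewrite -(integral21_prod_meas1 ic) integral0_eq// => y _.
  apply: (@integral_derive_compact _ (fun s => f (cons_rV (s, y)))
    (fun s => g (cons_rV (s, y))) M) => //.
  + by move=> s; apply: continuous_comp; [exact: continuous_cons_rV1|exact: cg].
  + move=> s; apply: is_derive_line (fg _) => h.
    by rewrite delta_mx0_cons -cons_rVD add0r [h *: _]mulr1.
  + by move=> s Ms; apply: z; exists ord0; rewrite cons_rV0.
Qed.

(** * Partial derivatives and smooth functions *)

Lemma near_eq_differentiable (R : realType) (U W : normedModType R)
  (f g : U -> W) (x : U) : (\near x, f x = g x) ->
  differentiable g x -> differentiable f x.
Proof.
move=> fg dg; have fgx : f x = g x by exact: nbhs_singleton fg.
have [dgc dgE] := (diff_locallyP _ _).1 dg.
have dfE : f \o shift x = cst (f x) + 'd g x +o_ 0 id.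
  apply/eqaddoP => e e0; move/eqaddoP : dgE => /(_ e e0).
  have : \forall h \near 0, f (h + x) = g (h + x).
    by move: fg; rewrite (near_shift 0 x) subr0.
  apply: filterS2 => h /= fgh; rewrite !fctE/= fgh fgx; exact.
apply/diff_locallyP; rewrite (diff_unique dgc dfE); split => //.
Qed.

Section partial_rules.
Context {R : realType} {n : nat}.
Implicit Types (f g : 'rV[R]_n -> R) (i : 'I_n) (x v : 'rV[R]_n).

Lemma derive_sum_partial f x v : differentiable f x ->
  'D_v f x = \sum_i v ord0 i * partial i f x.
Proof.
move=> df; rewrite deriveE//.
rewrite {1}[v]matrix_sum_delta big_ord1 linear_sum; apply: eq_bigr => i _.
by rewrite linearZ /= /partial deriveE.
Qed.

Lemma partial_cst i (c : R) x : partial i (fun=> c) x = 0.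
Proof. exact: derive_cst. Qed.

Lemma partialD i f g x : differentiable f x -> differentiable g x ->
  partial i (fun y => f y + g y) x = partial i f x + partial i g x.
Proof. by move=> df dg; apply: deriveD; exact: diff_derivable. Qed.

Lemma partialB i f g x : differentiable f x -> differentiable g x ->
  partial i (fun y => f y - g y) x = partial i f x - partial i g x.
Proof. by move=> df dg; apply: deriveB; exact: diff_derivable. Qed.

Lemma partialM i f g x : differentiable f x -> differentiable g x ->
  partial i (fun y => f y * g y) x = f x * partial i g x + g x * partial i f x.
Proof. by move=> df dg; apply: deriveM; exact: diff_derivable. Qed.

Lemma partial_sum i m (F : 'I_m -> 'rV[R]_n -> R) x :
  (forall k, differentiable (F k) x) ->
  partial i (fun y => \sum_k F k y) x = \sum_k partial i (F k) x.
Proof.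
move=> dF; rewrite -derive_sum => [|k]; last exact: diff_derivable.
by congr ('D_ _ _ x); rewrite fct_sumE.
Qed.

Lemma partial_coord i j x : partial i (fun y => y ord0 j) x = (j == i)%:R.
Proof.
rewrite /partial /derive /=.
apply: cvg_lim => //.
apply: (@cvg_trans _ ((fun=> (j == i)%:R : R) @ (0 : R)^')); last exact: cvg_cst.
apply: near_eq_cvg; near=> h; rewrite !mxE/= addrK.
rewrite -[_ *: _]/(h^-1 * _) mulKf//.
by near: h; exact: nbhs_dnbhs_neq.
Unshelve. all: by end_near. Qed.

Lemma partial_comp i (h : R -> R) f x (d : R) : differentiable f x ->
  is_derive (f x) (1 : R) h d -> partial i (h \o f) x = d * partial i f x.
Proof.
move=> df [dh <-].
have dh' : differentiable h (f x) by apply/derivable1_diffP.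
rewrite /partial !deriveE//; last exact: differentiable_comp.
rewrite diff_comp//= -[in LHS](mulr1 ('d f x _)).
by rewrite -[LHS]/('d h (f x) ('d f x (delta_mx ord0 i) *: 1)) linearZ mulrC.
Qed.

Lemma partial_near i f g x : (\near x, f x = g x) -> partial i f x = partial i g x.
Proof. exact: near_eq_derive. Qed.

End partial_rules.

Section smooth_functions.
Context {R : realType} {n : nat}.
Implicit Types (f g : 'rV[R]_n -> R) (i : 'I_n) (x v : 'rV[R]_n).

(** The predicate smooth quantifies over sequences of directions, whereas the
    product and chain rules call for an induction on the number of
    derivatives. *)
Fixpoint diff_upto (k : nat) f : Prop :=
  if k is k'.+1 then
    (forall x, differentiable f x) /\ forall i, diff_upto k' (partial i f)
  else True.

Lemma smooth_partial i f : smooth f -> smooth (partial i f).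
Proof. by move=> sf s x; have := sf (rcons s i) x; rewrite foldr_rcons. Qed.

Lemma smooth_diff f x : smooth f -> differentiable f x.
Proof. by move=> sf; exact: (sf [::]). Qed.

Lemma smooth_continuous f : smooth f -> continuous f.
Proof. by move=> sf x; apply: differentiable_continuous; exact: smooth_diff. Qed.

Lemma smoothP f : smooth f <-> forall k, diff_upto k f.
Proof.
split=> [sf k|Df s].
  elim: k f sf => [//|k IH] f sf; split; first by move=> x; exact: smooth_diff.
  by move=> i; apply: IH; exact: smooth_partial.
elim/last_ind: s f Df => [|s i IH] f Df x; first by have [] := Df 1%N.
rewrite foldr_rcons; apply: IH => k.
by have [_] := Df k.+1; exact.
Qed.

Lemma diff_upto_pred k f : diff_upto k.+1 f -> diff_upto k f.
Proof.
elim: k f => [//|k IH] f [df Df]; split => // i; exact/IH/Df.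
Qed.

Lemma diff_upto_cst k (c : R) : diff_upto k (fun=> c).
Proof.
elim: k c => [//|k IH] c; split=> [x|i]; first exact: differentiable_cst.
by rewrite (_ : partial i _ = fun=> 0)//; apply/funext => x; exact: partial_cst.
Qed.

Lemma diff_uptoD k f g : diff_upto k f -> diff_upto k g ->
  diff_upto k (fun x => f x + g x).
Proof.
elim: k f g => [//|k IH] f g [df Df] [dg Dg].
split=> [x|i]; first exact: differentiableD.
rewrite (_ : partial i _ = fun x => partial i f x + partial i g x).
  exact: IH (Df i) (Dg i).
by apply/funext => x; exact: partialD.
Qed.

Lemma diff_uptoM k f g : diff_upto k f -> diff_upto k g ->
  diff_upto k (fun x => f x * g x).
Proof.
elim: k f g => [//|k IH] f g Df Dg; have [df pf] := Df; have [dg pg] := Dg.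
split=> [x|i]; first exact: differentiableM.
rewrite (_ : partial i _ =
    fun x => f x * partial i g x + g x * partial i f x).
  apply: diff_uptoD; apply: IH.
  - exact: diff_upto_pred Df.
  - exact: pg.
  - exact: diff_upto_pred Dg.
  - exact: pf.
by apply/funext => x; exact: partialM.
Qed.

(** The outer function comes with all its derivatives h j: the chain rule
    replaces h j by h j.+1, so the induction must range over the family. *)
Lemma diff_upto_comp k (h : nat -> R -> R) f :
  (forall j (y : R), is_derive y (1 : R) (h j) (h j.+1 y)) ->
  diff_upto k f -> forall j, diff_upto k (h j \o f).
Proof.
move=> dh; elim: k f => [//|k IH] f Df j; have [df pf] := Df.
split=> [x|i].
  apply: differentiable_comp => //; apply/derivable1_diffP.
  by have [] := dh j (f x).
rewrite (_ : partial i _ = fun x => (h j.+1 \o f) x * partial i f x).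
  by apply: diff_uptoM; [apply: IH; exact: diff_upto_pred Df|exact: pf].
by apply/funext => x; exact: partial_comp.
Qed.

Lemma smooth_cst (c : R) : smooth (fun _ : 'rV[R]_n => c).
Proof. by apply/smoothP => k; exact: diff_upto_cst. Qed.

Lemma smooth_coord i : smooth (fun x => x ord0 i).
Proof.
apply/smoothP => -[//|k]; split=> [x|j]; first exact: differentiable_coord.
rewrite (_ : partial j _ = fun=> (i == j)%:R); first exact: diff_upto_cst.
by apply/funext => x; exact: partial_coord.
Qed.

Lemma smoothD f g : smooth f -> smooth g -> smooth (fun x => f x + g x).
Proof. by move=> /smoothP sf /smoothP sg; apply/smoothP => k; exact: diff_uptoD. Qed.

Lemma smoothM f g : smooth f -> smooth g -> smooth (fun x => f x * g x).
Proof. by move=> /smoothP sf /smoothP sg; apply/smoothP => k; exact: diff_uptoM. Qed.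

Lemma smoothB f g : smooth f -> smooth g -> smooth (fun x => f x - g x).
Proof.
move=> sf sg; rewrite (_ : (fun x => _) = fun x => f x + (- 1) * g x).
  by apply: smoothD => //; apply: smoothM => //; exact: smooth_cst.
by apply/funext => x; rewrite mulN1r.
Qed.

Lemma smooth_sum m (F : 'I_m -> 'rV[R]_n -> R) :
  (forall k, smooth (F k)) -> smooth (fun x => \sum_k F k x).
Proof.
elim: m F => [|m IH] F sF.
  rewrite (_ : (fun x => _) = fun=> 0); first exact: smooth_cst.
  by apply/funext => x; rewrite big_ord0.
rewrite (_ : (fun x => _) = fun x => F ord0 x + \sum_k F (lift ord0 k) x).
  by apply: smoothD => //; exact: IH.
by apply/funext => x; rewrite big_ord_recl.
Qed.

Lemma smooth_comp (h : nat -> R -> R) f j :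
  (forall j (y : R), is_derive y (1 : R) (h j) (h j.+1 y)) ->
  smooth f -> smooth (h j \o f).
Proof.
by move=> dh /smoothP sf; apply/smoothP => k; exact: diff_upto_comp.
Qed.

Lemma near_foldr_partial f g s x : (\near x, f x = g x) ->
  \near x, foldr (@partial R n) f s x = foldr (@partial R n) g s x.
Proof.
elim: s => [//|i s IH] /IH/near_join fg /=.
apply: filterS fg => y; exact: partial_near.
Qed.

(** Smoothness is local, which allows gluing along overlapping open sets. *)
Lemma smooth_near f :
  (forall x, exists2 g, smooth g & \near x, f x = g x) -> smooth f.
Proof.
move=> sf s x; have [g sg fg] := sf x.
apply: near_eq_differentiable (sg s x); exact: near_foldr_partial.
Qed.

End smooth_functions.

(** * A smooth cutoff on the line *)

Section bump.
Context {R : realType}.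
Implicit Types (p : {poly R}) (x : R).

(** All derivatives of exp (- 1 / x), extended by 0 to x <= 0, have this form. *)
Definition flat p x := if 0 < x then p.[x^-1] * expR (- x^-1) else 0.

(** The derivative of p (1 / x) exp (- 1 / x) is q (1 / x) exp (- 1 / x) for
    this polynomial q. *)
Definition flat_next p : {poly R} := 'X^2 * (p - p^`()).

Lemma horner_le_pow p : exists2 C, 0 <= C &
  forall y : R, 1 <= y -> `|p.[y]| <= C * y ^+ size p.
Proof.
exists (\sum_(i < size p) `|p`_i|); first exact: sumr_ge0.
move=> y y1; rewrite horner_coef mulr_suml (le_trans (ler_norm_sum _ _ _))//.
apply: ler_sum => i _; rewrite normrM normrX (ger0_norm (le_trans ler01 y1)).
by rewrite ler_wpM2l// ler_weXn2l// ltnW.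
Qed.

(** With y = 1 / x and k = size p + 2, the inequality y ^ k / k! <= exp y beats
    the growth of p and leaves a factor x ^ 2, which makes the derivative at
    the origin 0. *)
Lemma flat_le_sqr p : exists2 C, 0 <= C &
  forall x, `|x| <= 1 -> `|flat p x| <= C * x ^+ 2.
Proof.
have [C C0 pC] := horner_le_pow p.
pose k := (size p).+2.
exists (C * k`!%:R) => [|x]; first by rewrite mulr_ge0.
rewrite /flat; case: ifPn => [x0|_] x1; last first.
  by rewrite normr0 mulr_ge0 ?sqr_ge0// mulr_ge0.
have xV1 : 1 <= x^-1 by rewrite invf_ge1// (le_trans (ler_norm _) x1).
have xV0 : 0 < x^-1 by rewrite invr_gt0.
have ek : x^-1 ^+ k / k`!%:R <= expR x^-1.
  by apply: le_trans (@expR_ge1Dxn R x^-1 (size p).+1 (ltW xV0)); rewrite lerDr.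
have : expR (- x^-1) <= k`!%:R / x^-1 ^+ k.
  rewrite expRN -[leRHS]invf_div lef_pV2// posrE ?expR_gt0//.
  by rewrite divr_gt0 ?exprn_gt0// ltr0n fact_gt0.
move=> eV; rewrite normrM [`|expR _|]ger0_norm ?expR_ge0//.
apply: le_trans (ler_pM _ _ (pC _ xV1) eV) _; rewrite ?expR_ge0//.
rewrite le_eqVlt; apply/orP; left; apply/eqP.
rewrite -[LHS]mulrA -mulrA; congr (_ * _).
rewrite /k -addn2 exprD invfM mulrCA; congr (_ * _).
by rewrite mulrA mulfV ?mul1r ?expf_neq0 ?gt_eqF// exprVn invrK.
Qed.

Lemma is_derive_quadratic (f : R -> R) (C e : R) : 0 < e ->
  (forall x, `|x| <= e -> `|f x - f 0| <= C * x ^+ 2) ->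
  is_derive (0 : R) (1 : R) f 0.
Proof.
move=> e0 fC.
have H : (fun h : R => h^-1 *: ((f \o shift 0) (h *: 1) - f 0)) @ (0 : R)^' --> (0 : R).
  apply/cvgrPdist_lt => d d0; near=> h.
  rewrite /= addr0 sub0r normrN normrZ [h *: 1]mulr1.
  have h0 : h != 0 by near: h; exact: nbhs_dnbhs_neq.
  have he : `|h| <= e by near: h; apply: dnbhs0_le.
  have hd : `|h| <= d / 2 / (`|C| + 1).
    by near: h; apply: dnbhs0_le; rewrite !divr_gt0// ltr_pwDr.
  rewrite normfV ltr_pdivrMl ?normr_gt0// (le_lt_trans (fC _ he))//.
  rewrite -real_normK ?num_real// expr2 mulrA mulrC ltr_pM2l ?normr_gt0//.
  move: hd; rewrite ler_pdivlMr ?ltr_pwDr// mulrDr mulr1.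
  have := normr_ge0 h; have : C * `|h| <= `|h| * `|C|.
    by rewrite mulrC ler_wpM2l// ler_norm.
  lra.
split; first by apply/cvg_ex; exists 0.
exact: cvg_lim H.
Unshelve. all: by end_near. Qed.

Lemma is_derive_flat p x : is_derive x (1 : R) (flat p) (flat (flat_next p) x).
Proof.
have [x0|x0|->] := ltgtP x 0.
- have -> : flat (flat_next p) x = 0 by rewrite /flat ltNge ltW.
  apply: (@near_eq_is_derive R R R (cst 0) (flat p) x 1 0 _ (is_derive_cst _ _ _)).
  near=> y; rewrite /flat /= ifF//; apply/negbTE; rewrite -leNgt ltW//.
  by near: y; exact: lt_nbhsl.
- have E : flat (flat_next p) x = p.[x^-1] * (expR (- x^-1) * x^-2)
     + expR (- x^-1) * (p^`().[x^-1] * - x^-2).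
    rewrite /flat x0 /flat_next hornerM hornerXn hornerD hornerN exprVn.
    ring.
  rewrite E.
  apply: (@near_eq_is_derive _ _ _
    ((horner p \o (fun y => y^-1)) * (expR \o (fun y => - y^-1)))).
    near=> y; rewrite /flat ifT//.
    by near: y; exact: lt_nbhsr.
  have dV : is_derive x (1 : R) (fun y => y^-1) (- x^-2).
    have := @is_deriveV R id x 1 1; rewrite /= gt_eqF// => /(_ isT (is_derive_id _ _)).
    by rewrite [_ *: 1]mulr1.
  have dN : is_derive x (1 : R) (fun y => - y^-1) (x^-2).
    by rewrite -[x^-2]opprK; exact: is_deriveN.
  have d1 := @is_derive1_comp R (horner p) _ x _ _ (is_derive_poly p x^-1) dV.
  have d2 := @is_derive1_comp R expR _ x _ _ (is_derive_expR (- x^-1)) dN.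
  exact: is_deriveM.
- rewrite {2}/flat ltxx.
  have [C C0 fC] := flat_le_sqr p.
  apply: (@is_derive_quadratic _ C 1) => // y /fC.
  by rewrite [flat p 0]/flat ltxx subr0.
Unshelve. all: by end_near. Qed.

Definition flat_iter j := flat (iter j flat_next 1).

Lemma flat1_gt0 x : 0 < x -> 0 < flat 1 x.
Proof. by move=> x0; rewrite /flat x0 hornerC mul1r expR_gt0. Qed.

Lemma flat1_ge0 x : 0 <= flat 1 x.
Proof. by rewrite /flat; case: ifP => // _; rewrite hornerC mul1r expR_ge0. Qed.

Lemma flat_le0 p x : x <= 0 -> flat p x = 0.
Proof. by rewrite /flat ltNge => ->. Qed.

Lemma flat_next1_ge0 x : 0 <= flat (flat_next 1) x.
Proof.
rewrite /flat; case: ifP => // _; rewrite /flat_next derivC subr0 mulr1.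
by rewrite hornerXn mulr_ge0 ?expR_ge0// sqr_ge0.
Qed.

Lemma flat1_le x y : x <= y -> flat 1 x <= flat 1 y.
Proof.
move=> xy; have [x0|x0] := leP x 0; first by rewrite (flat_le0 _ x0) flat1_ge0.
have y0 := lt_le_trans x0 xy.
by rewrite /flat x0 y0 !hornerC !mul1r ler_expR lerN2 lef_pV2.
Qed.

(** For A < B, the inner quotient is 0 up to A and at least 1 from B on, so the
    cutoff is the positive constant flat 1 1 up to A and 0 from B on. *)
Definition cutoff (A B s : R) := flat 1 (1 - flat 1 (s - A) / flat 1 (B - A)).

Definition cutoff_deriv (A B s : R) :=
  flat (flat_next 1) (1 - flat 1 (s - A) / flat 1 (B - A)) *
  - (flat (flat_next 1) (s - A) / flat 1 (B - A)).

Lemma is_derive_cutoff A B s : is_derive s (1 : R) (cutoff A B) (cutoff_deriv A B s).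
Proof.
have d1 : is_derive s (1 : R) (fun s => s - A) 1.
  rewrite -[X in is_derive _ _ _ X]subr0.
  exact: (@is_deriveB _ _ _ id (cst A) s 1 1 0 (is_derive_id _ _) (is_derive_cst _ _ _)).
have d2 := @is_derive1_comp R _ _ s _ _ (is_derive_flat 1 (s - A)) d1.
have d3 : is_derive s (1 : R) (fun s => 1 - flat 1 (s - A) / flat 1 (B - A))
    (- (flat (flat_next 1) (s - A) / flat 1 (B - A))).
  have := @is_deriveM _ _ _ (cst (flat 1 (B - A))^-1) s 1 _ _ d2 (is_derive_cst _ _ _).
  move=> /(is_deriveB (is_derive_cst (1 : R) s 1)).
  rewrite scaler0 !add0r mulr1 [_ *: _]mulrC; exact.
exact: is_derive1_comp (is_derive_flat _ _) d3.
Qed.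

Lemma cutoff_deriv_le0 A B s : cutoff_deriv A B s <= 0.
Proof.
rewrite /cutoff_deriv mulrN oppr_le0 mulr_ge0 ?flat_next1_ge0//.
by rewrite divr_ge0 ?flat_next1_ge0 ?flat1_ge0.
Qed.

Lemma cutoff_ge0 A B s : 0 <= cutoff A B s.
Proof. exact: flat1_ge0. Qed.

Lemma cutoff_eq0 A B s : A < B -> B <= s -> cutoff A B s = 0.
Proof.
move=> AB Bs; apply: flat_le0; rewrite subr_le0 ler_pdivlMr ?mul1r.
  by apply: flat1_le; rewrite lerD2r.
by rewrite flat1_gt0 ?subr_gt0.
Qed.

Lemma cutoff_cst A B s : s <= A -> cutoff A B s = flat 1 1.
Proof. by move=> sA; rewrite /cutoff (@flat_le0 _ (s - A)) ?subr_le0// mul0r subr0. Qed.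

Lemma cutoff_deriv_eq0 A B s : s <= A -> cutoff_deriv A B s = 0.
Proof.
move=> sA; rewrite /cutoff_deriv (@flat_le0 (flat_next 1) (s - A)) ?subr_le0//.
by rewrite mul0r oppr0 mulr0.
Qed.

Lemma smooth_cutoff n A B (q : 'rV[R]_n -> R) : smooth q ->
  smooth (fun z => cutoff A B (q z)).
Proof.
have dflat j (y : R) : is_derive y (1 : R) (flat_iter j) (flat_iter j.+1 y).
  exact: is_derive_flat.
move=> sq; have s1 : smooth (fun z => q z - A) by apply: smoothB => //; exact: smooth_cst.
have s2 : smooth (flat_iter 0 \o (fun z => q z - A)) by exact: smooth_comp.
apply: (@smooth_comp _ _ flat_iter
  (fun z => 1 - flat 1 (q z - A) / flat 1 (B - A)) 0 dflat).
apply: smoothB; first exact: smooth_cst.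
by apply: smoothM => //; exact: smooth_cst.
Qed.

End bump.

(** * The divergence theorem for compact supports *)

Section continuous_arith.
Context {R : realType} {T : topologicalType}.
Implicit Types f g : T -> R.

Lemma continuous_add f g : continuous f -> continuous g ->
  continuous (fun x => f x + g x).
Proof. by move=> cf cg x; apply: (@continuousD _ _ _ f g x (cf x) (cg x)). Qed.

Lemma continuous_mul f g : continuous f -> continuous g ->
  continuous (fun x => f x * g x).
Proof. by move=> cf cg x; apply: (@continuousM _ _ f g x (cf x) (cg x)). Qed.

Lemma continuous_sum m (F : 'I_m -> T -> R) : (forall k, continuous (F k)) ->
  continuous (fun x => \sum_k F k x).
Proof.
elim: m F => [|m IH] F cF.
  rewrite (_ : (fun x => _) = fun=> 0); first exact: cst_continuous.
  by apply/funext => x; rewrite big_ord0.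
rewrite (_ : (fun x => _) = fun x => F ord0 x + \sum_k F (lift ord0 k) x).
  by apply: continuous_add => //; exact: IH.
by apply/funext => x; rewrite big_ord_recl.
Qed.

End continuous_arith.

Section C1.
Context {R : realType} {n : nat}.
Implicit Types (f g : 'rV[R]_n -> R) (Omega K : set 'rV[R]_n).
Local Notation mu := (lebesgue_rV R n).

Definition tsupport f := closure [set x | f x != 0].

Definition C1 f :=
  (forall x, differentiable f x) /\ forall i, continuous (partial i f).

Definition C1c Omega f := [/\ C1 f, compact (tsupport f) & tsupport f `<=` Omega].

Lemma C1_continuous f : C1 f -> continuous f.
Proof. by move=> [df _] x; exact: differentiable_continuous. Qed.

Lemma smooth_C1 f : smooth f -> C1 f.
Proof.
move=> sf; split=> [x|i]; first exact: smooth_diff.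
by apply: smooth_continuous; exact: smooth_partial.
Qed.

Lemma test_function_C1c Omega f : test_function Omega f -> C1c Omega f.
Proof. by move=> [sf cf fO]; split => //; exact: smooth_C1. Qed.

Lemma C1M f g : C1 f -> C1 g -> C1 (fun x => f x * g x).
Proof.
move=> Cf Cg; have [df pf] := Cf; have [dg pg] := Cg.
split=> [x|i]; first exact: differentiableM.
rewrite (_ : partial i _ =
    fun x => f x * partial i g x + g x * partial i f x); last first.
  by apply/funext => x; exact: partialM.
apply: continuous_add.
  by apply: continuous_mul; [exact: C1_continuous|exact: pg].
by apply: continuous_mul; [exact: C1_continuous|exact: pf].
Qed.

Lemma tsupport0 f x : ~ tsupport f x -> f x = 0.
Proof.
by move=> sfx; apply/eqP; apply: contra_notT sfx => fx0; exact: subset_closure.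
Qed.

Lemma partial_tsupport0 i f x : ~ tsupport f x -> partial i f x = 0.
Proof.
move=> sfx; rewrite -(partial_cst i 0 x); apply: partial_near.
have oC : open (~` tsupport f) by apply: closed_openC; exact: closed_closure.
have : nbhs x (~` tsupport f) by exact: open_nbhs_nbhs.
by apply: filterS => y; exact: tsupport0.
Qed.

Lemma tsupportM f g : tsupport (fun x => f x * g x) `<=` tsupport f.
Proof.
by apply: closure_subset => x /=; apply: contra_neq => ->; rewrite mul0r.
Qed.

Lemma C1cM Omega f g : C1c Omega f -> C1 g -> C1c Omega (fun x => f x * g x).
Proof.
move=> [Cf cf fO] Cg; split; first exact: C1M.
  by apply: subclosed_compact cf (@tsupportM _ _); exact: closed_closure.
by apply: subset_trans fO; exact: tsupportM.
Qed.

Lemma compact_bounded_rV K : compact K ->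
  exists2 M, 0 < M & forall x, K x -> `|x| < M.
Proof.
move=> /compact_bounded[M [_ hM]]; exists (`|M| + 2) => [|x Kx].
  by rewrite ltr_wpDl.
have := hM (`|M| + 1) _ x Kx => /(_ _)/le_lt_trans; apply; last by rewrite ltrD2l ltr1n.
by rewrite ltr_pwDr// ler_norm.
Qed.

Lemma integrable_compact Omega K f : measurable Omega -> compact K ->
  continuous f -> (forall x, ~ K x -> f x = 0) ->
  mu.-integrable Omega (EFin \o f).
Proof.
move=> mO cK cf f0; have [M M0 KM] := compact_bounded_rV cK.
apply: (integrableS measurableT) => //.
apply: (@integrable_continuous_compact_rV _ _ 0 M) => // x.
rewrite -ball_normE/= sub0r normrN => fx0; apply: KM.
by apply: contrapT => /f0/eqP; rewrite (negbTE fx0).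
Qed.

Lemma Rintegral_partial0 Omega f i : measurable Omega -> C1c Omega f ->
  \int[mu]_(x in Omega) partial i f x = 0.
Proof.
move=> mO [[df pf] cf fO].
rewrite Rintegral_mkcond (_ : _ \_ _ = partial i f); last first.
  apply/funext => x; rewrite patchE; case: ifPn => // /negP xO.
  by rewrite partial_tsupport0// => /fO /mem_set.
have [M M0 KM] := compact_bounded_rV cf.
have dfx (x : 'rV[R]_n) : is_derive x (delta_mx ord0 i) f (partial i f x).
  by apply: derivableP; exact: diff_derivable.
rewrite /Rintegral (integral_partial_compact M0 (pf i) dfx)//.
move=> x [j Mx]; have sx : ~ tsupport f x.
  move=> /KM; rewrite ltNge => /negP; apply; apply: le_trans Mx _.
  exact: coord_le_norm.
by rewrite tsupport0// partial_tsupport0.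
Qed.

Lemma Rintegral_sum Omega m (F : 'I_m -> 'rV[R]_n -> R) : measurable Omega ->
  (forall k, mu.-integrable Omega (EFin \o F k)) ->
  \int[mu]_(x in Omega) (\sum_k F k x) = \sum_k \int[mu]_(x in Omega) F k x.
Proof.
move=> mO; elim: m F => [|m IH] F iF.
  by under eq_Rintegral do rewrite big_ord0; rewrite big_ord0 Rintegral_cst// mul0r.
under eq_Rintegral do rewrite big_ord_recl.
rewrite big_ord_recl RintegralD//; first by rewrite IH.
rewrite (_ : _ \o _ = fun x => \sum_(k < m) (EFin \o F (lift ord0 k)) x)%E.
  by apply: integrable_sum.
by apply/funext => x /=; rewrite sumEFin.
Qed.

(** Each product f X_i has compact support in Omega, so its partial derivatives
    have integral 0 over Omega. *)
Lemma divergence_theorem Omega f (X : 'rV[R]_n -> 'rV[R]_n) :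
  measurable Omega -> C1c Omega f -> (forall i, C1 (fun x => X x ord0 i)) ->
  \int[mu]_(x in Omega) (f x * divergence X x) =
  - \int[mu]_(x in Omega) \sum_i X x ord0 i * partial i f x.
Proof.
move=> mO Cf CX; have [[df pf] cf fO] := Cf.
have int1 i : mu.-integrable Omega
    (EFin \o fun x => f x * partial i (fun y => X y ord0 i) x).
  apply: (integrable_compact mO cf).
    by apply: continuous_mul; [exact: C1_continuous|exact: (CX i).2].
  by move=> x sx; rewrite tsupport0// mul0r.
have int2 i : mu.-integrable Omega (EFin \o fun x => X x ord0 i * partial i f x).
  apply: (integrable_compact mO cf).
    by apply: continuous_mul; [exact: (C1_continuous (CX i))|exact: pf].
  by move=> x sx; rewrite partial_tsupport0// mulr0.
rewrite (@Rintegral_sum _ _ (fun i x => X x ord0 i * partial i f x))//.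
rewrite /divergence; under eq_Rintegral do rewrite mulr_sumr.
rewrite Rintegral_sum// -sumrN; apply: eq_bigr => i _.
apply/eqP; rewrite -addr_eq0 -RintegralD//; apply/eqP.
rewrite -[RHS](Rintegral_partial0 i mO (C1cM Cf (CX i))).
by apply: eq_Rintegral => x _; rewrite partialM//; exact: (CX i).1.
Qed.

End C1.

(** * The Euclidean norm *)

Section enorm.
Context {R : realType} {n : nat}.
Implicit Types x y : 'rV[R]_n.

Lemma enorm_ge0 x : 0 <= enorm x.
Proof. exact: sqrtr_ge0. Qed.

Lemma enorm_sqr x : enorm x ^+ 2 = \sum_i x ord0 i ^+ 2.
Proof. by rewrite sqr_sqrtr// sumr_ge0// => i _; exact: sqr_ge0. Qed.

Lemma enorm0 : enorm (0 : 'rV[R]_n) = 0.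
Proof.
apply/eqP; rewrite -sqrf_eq0 enorm_sqr big1// => i _.
by rewrite mxE expr0n.
Qed.

Lemma enormZ (c : R) x : enorm (c *: x) = `|c| * enorm x.
Proof.
rewrite /enorm -sqrtr_sqr -sqrtrM ?sqr_ge0// mulr_sumr; congr Num.sqrt.
by apply: eq_bigr => i _; rewrite mxE exprMn.
Qed.

Lemma coord_le_enorm x i : `|x ord0 i| <= enorm x.
Proof.
rewrite -sqrtr_sqr ler_wsqrtr// (bigD1 i)//= lerDl sumr_ge0// => j _.
exact: sqr_ge0.
Qed.

Lemma coord_eq0_enorm x : enorm x = 0 -> forall i, x ord0 i = 0.
Proof.
by move=> x0 i; apply/eqP; rewrite -normr_le0 -x0 coord_le_enorm.
Qed.

Lemma CauchySchwarz_enorm x y : \sum_i x ord0 i * y ord0 i <= enorm x * enorm y.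
Proof.
have [x0|x0] := eqVneq (enorm x) 0.
  by rewrite x0 mul0r big1// => i _; rewrite coord_eq0_enorm ?mul0r.
have [y0|y0] := eqVneq (enorm y) 0.
  by rewrite y0 mulr0 big1// => i _; rewrite (coord_eq0_enorm y0) mulr0.
have {}x0 : 0 < enorm x by rewrite lt0r x0 enorm_ge0.
have {}y0 : 0 < enorm y by rewrite lt0r y0 enorm_ge0.
(* The difference of the two sides is the sum of (b x_i - a y_i)^2 / (2 a b). *)
set a := enorm x in x0 *; set b := enorm y in y0 *.
have -> : a * b = \sum_i (b / a * x ord0 i ^+ 2 + a / b * y ord0 i ^+ 2) / 2.
  rewrite -mulr_suml big_split/= -!mulr_sumr -!enorm_sqr -/a -/b.
  by field; rewrite !gt_eqF.
apply: ler_sum => i _.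
set s := x ord0 i; set t := y ord0 i.
rewrite -subr_ge0.
have -> : (b / a * s ^+ 2 + a / b * t ^+ 2) / 2 - s * t =
    (b * s - a * t) ^+ 2 / (2 * a * b).
  by field; rewrite !gt_eqF.
by rewrite divr_ge0 ?sqr_ge0// !mulr_ge0// ltW.
Qed.

Lemma enormD x y : enorm (x + y) <= enorm x + enorm y.
Proof.
rewrite -(@ler_pXn2r _ 2)// ?nnegrE ?addr_ge0 ?enorm_ge0//.
rewrite enorm_sqr sqrrD !enorm_sqr.
under eq_bigr do rewrite mxE sqrrD.
rewrite !big_split/= lerD2r lerD2l.
by rewrite mulr2n lerD ?CauchySchwarz_enorm.
Qed.

Lemma enorm_le_sum x : enorm x <= \sum_i `|x ord0 i|.
Proof.
have [->|x0] := eqVneq (enorm x) 0; first exact: sumr_ge0.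
rewrite -(@ler_pM2r _ (enorm x)); last by rewrite lt0r x0 enorm_ge0.
rewrite -expr2 enorm_sqr mulr_suml; apply: ler_sum => i _.
by rewrite -real_normK ?num_real// expr2 ler_wpM2l// coord_le_enorm.
Qed.

Lemma enorm_le_norm x : enorm x <= n%:R * `|x|.
Proof.
rewrite -(@ler_pXn2r _ 2)// ?nnegrE ?mulr_ge0 ?enorm_ge0//.
rewrite enorm_sqr (@le_trans _ _ (\sum_(i < n) `|x| ^+ 2))//.
  apply: ler_sum => i _; rewrite -real_normK ?num_real// ler_pXn2r ?nnegrE//.
  exact: coord_le_norm.
rewrite sumr_const card_ord exprMn -[leLHS]mulr_natl.
apply: ler_wpM2r; first exact: sqr_ge0.
by rewrite -natrX ler_nat; case: n => // m; rewrite leq_pmull.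
Qed.

Lemma norm_le_enorm x : `|x| <= enorm x.
Proof.
rewrite [leLHS]mx_normrE; apply: bigmax_le; first exact: enorm_ge0.
by move=> [i j] _ /=; rewrite (ord1 i) coord_le_enorm.
Qed.

Lemma continuous_enorm : continuous (@enorm R n).
Proof.
move=> x; apply: continuous_comp; last exact: sqrt_continuous.
apply: continuous_sum => i y.
by apply: (@continuous_comp _ _ _ (fun y : 'rV[R]_n => y ord0 i) (fun z => z ^+ 2));
  [exact: coord_continuous|exact: exprn_continuous].
Qed.

Lemma integrable_enorm (D : set 'rV[R]_n) (g : 'rV[R]_n -> 'rV[R]_n) :
  measurable D ->
  (forall i, (lebesgue_rV R n).-integrable D (EFin \o (fun x => g x ord0 i))) ->
  (lebesgue_rV R n).-integrable D (EFin \o (fun x => enorm (g x))).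
Proof.
move=> mD ig.
apply: (@le_integrable _ _ _ _ D mD _ (fun x => \sum_i `|(g x ord0 i)%:E|)%E).
- have mh : measurable_fun D (fun x => \sum_i (g x ord0 i) ^+ 2).
    apply: measurable_sum => i; apply: measurable_funX.
    by apply/measurable_EFinP; exact: measurable_int (ig i).
  apply/measurable_EFinP.
  exact: (measurableT_comp (continuous_measurable_fun (@sqrt_continuous R)) mh).
- move=> x _ /=; rewrite sumEFin lee_fin !ger0_norm ?sumr_ge0 ?enorm_ge0//.
  exact: enorm_le_sum.
- apply: (@integrable_sum _ _ _ _ _ mD _ _ _ (fun i x => `|(g x ord0 i)%:E|%E)) => i _.
  exact: (integrable_abse (ig i)).
Qed.

End enorm.

(** * Calibrations bound the eigenvalue *)

Section soft_abs.
Context {R : realType}.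

Implicit Types d s : R.
(** For d > 0, a C1 function between |s| - d and |s|.  It vanishes at 0, so that
    composing with it does not enlarge supports. *)
Definition soft_abs (d s : R) := Num.sqrt (s ^+ 2 + d ^+ 2) - d.

(** The derivative of soft_abs d. *)
Definition soft_sign (d s : R) := s / Num.sqrt (s ^+ 2 + d ^+ 2).

Lemma soft_abs0 d : 0 < d -> soft_abs d 0 = 0.
Proof.
by move=> d0; rewrite /soft_abs expr0n/= add0r sqrtr_sqr gtr0_norm// subrr.
Qed.

Lemma soft_abs_ge d s : `|s| - d <= soft_abs d s.
Proof.
by rewrite /soft_abs lerD2r -sqrtr_sqr ler_wsqrtr// lerDl sqr_ge0.
Qed.

Lemma soft_abs_gt0 d s : 0 < d -> 0 < s ^+ 2 + d ^+ 2.
Proof. by move=> d0; rewrite ltr_wpDl ?sqr_ge0// exprn_gt0. Qed.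

Lemma soft_sign_le1 d s : 0 < d -> `|soft_sign d s| <= 1.
Proof.
move=> d0; rewrite /soft_sign normrM normfV ler_pdivrMr; last first.
  by rewrite normr_gt0 gt_eqF// sqrtr_gt0 soft_abs_gt0.
rewrite mul1r [leRHS]ger0_norm ?sqrtr_ge0// -sqrtr_sqr ler_wsqrtr//.
by rewrite lerDl sqr_ge0.
Qed.

Lemma is_derive_soft_abs d s : 0 < d ->
  is_derive s (1 : R) (soft_abs d) (soft_sign d s).
Proof.
move=> d0; have sd := soft_abs_gt0 s d0.
have d1 : is_derive s (1 : R) (fun y => y ^+ 2 + d ^+ 2) (2 * s).
  have := is_deriveD (is_deriveX 2 (is_derive_id s (1 : R))) (is_derive_cst (d ^+ 2) s 1).
  by rewrite addr0 expr1 [_ *: _]mulr1.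
have d2 := @is_derive1_comp R Num.sqrt
  (fun y => y ^+ 2 + d ^+ 2) s _ _ (is_derive1_sqrt sd) d1.
have := is_deriveB d2 (is_derive_cst d s 1).
rewrite subr0 (_ : _ * (2 * s) = soft_sign d s)//.
by rewrite /soft_sign; field; rewrite gt_eqF// sqrtr_gt0.
Qed.

Lemma continuous_soft_sign d : 0 < d -> continuous (soft_sign d).
Proof.
move=> d0; apply: continuous_mul; first by move=> x; exact: cvg_id.
move=> x; apply: cvgV; first by rewrite gt_eqF// sqrtr_gt0 soft_abs_gt0.
have c1 : continuous (fun y : R => y ^+ 2 + d ^+ 2).
  by apply: continuous_add; [exact: exprn_continuous|exact: cst_continuous].
exact: (continuous_comp (c1 x) (@sqrt_continuous R _)).
Qed.

Lemma C1c_soft_abs n (Omega : set 'rV[R]_n) d (f : 'rV[R]_n -> R) : 0 < d ->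
  C1c Omega f -> C1c Omega (fun x => soft_abs d (f x)).
Proof.
move=> d0 [Cf cf fO]; have [df pf] := Cf.
have ss : tsupport (fun x => soft_abs d (f x)) `<=` tsupport f.
  by apply: closure_subset => x /=; apply: contra_neq => ->; exact: soft_abs0.
split; last exact: subset_trans fO.
  split=> [x|i].
    apply: differentiable_comp => //; apply/derivable1_diffP.
    by have [] := is_derive_soft_abs (f x) d0.
  rewrite (_ : partial i _ = fun x => soft_sign d (f x) * partial i f x).
    apply: continuous_mul => //.
    move=> x; apply: continuous_comp; first exact: C1_continuous.
    exact: continuous_soft_sign.
  apply/funext => x; apply: partial_comp => //; exact: is_derive_soft_abs.
by apply: subclosed_compact cf ss; exact: closed_closure.
Qed.

End soft_abs.

Section lower_bound.
Context {R : realType} {n : nat}.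
Local Notation mu := (lebesgue_rV R n).

(** For a test function phi close to u, the divergence theorem applied to
    soft_abs d of phi bounds c int |phi| by K int |g| up to an error that
    vanishes with d and with the distance from phi to u. *)
Lemma calibration_lower_bound (Omega : set 'rV[R]_n) (X : 'rV[R]_n -> 'rV[R]_n)
    (K c : R) u g :
  measurable Omega -> (mu Omega < +oo)%E -> 0 < K -> 0 <= c ->
  (forall i, C1 (fun x => X x ord0 i)) ->
  (forall x, Omega x -> divergence X x = c) ->
  (forall x, Omega x -> enorm (X x) <= K) ->
  sobolev11_0 Omega u g -> \int[mu]_(x in Omega) `|u x| = 1 ->
  c / K <= \int[mu]_(x in Omega) enorm (g x).
Proof.
move=> mO fO K0 c0 CX divX XK [[iu ig _] appr] u1.
rewrite ler_pdivrMr// mulrC.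
set I := \int[mu]_(x in Omega) enorm (g x).
set m := fine (mu Omega).
have m0 : 0 <= m by exact: fine_ge0.
apply/ler_addgt0Pr => eta eta0.
(* Thus (K + 2 c) e <= eta, and d times the measure of Omega is at most e. *)
pose e := eta / (K + 2 * c + 1).
have D0 : 0 < K + 2 * c + 1 by rewrite ltr_pwDr// addr_ge0 ?mulr_ge0// ltW.
have e0 : 0 < e by rewrite divr_gt0.
pose d := e / (m + 1).
have d0 : 0 < d by rewrite divr_gt0// ltr_pwDr.
have [phi tphi] := appr e e0; rewrite /sobolev11_norm => He.
have Cphi := test_function_C1c tphi.
have Cf := C1c_soft_abs d0 Cphi.
set f := (fun x => soft_abs d (phi x)) in Cf.
have [C1phi cphi phiO] := Cphi; have [dphi pphi] := C1phi.
have [C1f cf fOm] := Cf; have [df pf] := C1f.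
have iphi : mu.-integrable Omega (EFin \o phi).
  apply: (integrable_compact mO cphi); first exact: C1_continuous C1phi.
  by move=> x; exact: tsupport0.
have igphi i : mu.-integrable Omega (EFin \o fun x => grad phi x ord0 i).
  under eq_fun do rewrite mxE.
  by apply: (integrable_compact mO cphi) => // x; exact: partial_tsupport0.
have if_ : mu.-integrable Omega (EFin \o f).
  apply: (integrable_compact mO cf); first exact: C1_continuous C1f.
  by move=> x; exact: tsupport0.
have iXf : mu.-integrable Omega (EFin \o fun x => \sum_i X x ord0 i * partial i f x).
  apply: (integrable_compact mO cf).
    by apply: continuous_sum => i; apply: continuous_mul => //; exact: C1_continuous.
  by move=> x xf; rewrite big1// => i _; rewrite partial_tsupport0 ?mulr0.
have iNXf : mu.-integrable Omega (EFin \o fun x => - \sum_i X x ord0 i * partial i f x).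
  exact: integrableN iXf.
have ieg : mu.-integrable Omega (EFin \o fun x => enorm (g x)) by exact: integrable_enorm.
have iegphi : mu.-integrable Omega (EFin \o fun x => enorm (g x - grad phi x)).
  apply: integrable_enorm => // i.
  under eq_fun do rewrite mxE [X in _ + X]mxE.
  exact: (integrableB mO (ig i) (igphi i)).
have iuphi : mu.-integrable Omega (EFin \o fun x => u x - phi x).
  exact: (integrableB mO iu iphi).
have ione : mu.-integrable Omega (EFin \o fun=> d).
  apply: measurable_bounded_integrable => //.
  exact: bounded_cst.
have H1 : c * \int[mu]_(x in Omega) f x <= K * (I + e).
  rewrite -RintegralZl// (_ : \int[mu]_(x in Omega) (c * f x) =
     \int[mu]_(x in Omega) (f x * divergence X x)); last first.
    by apply: eq_Rintegral => x /set_mem xO; rewrite divX// mulrC.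
  rewrite (divergence_theorem mO Cf CX) -mulN1r -RintegralZl//.
  under eq_Rintegral do rewrite mulN1r.
  have iK : mu.-integrable Omega
      (EFin \o fun x => K * (enorm (g x) + enorm (g x - grad phi x))).
    exact: (integrableZl mO K (integrableD mO ieg iegphi)).
  apply: (@le_trans _ _
    (\int[mu]_(x in Omega) (K * (enorm (g x) + enorm (g x - grad phi x))))).
    apply: le_Rintegral => // x xO.
    rewrite -sumrN.
    (* The gradient of phi is g minus a remainder, whose norm has integral below e. *)
    have -> : \sum_i - (X x ord0 i * partial i f x) =
        \sum_i ((- soft_sign d (phi x)) *: X x) ord0 i * g x ord0 i +
        \sum_i (soft_sign d (phi x) *: X x) ord0 i * (g x - grad phi x) ord0 i.
      rewrite -big_split; apply: eq_bigr => i _ /=; rewrite !mxE.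
      rewrite [partial i f x](partial_comp i (dphi x) (is_derive_soft_abs (phi x) d0)).
      by ring.
    have XK1 (b : R) : `|b| <= 1 -> enorm (b *: X x) <= K.
      move=> b1; rewrite enormZ -[K]mul1r; apply: ler_pM => //; first exact: enorm_ge0.
      exact: XK.
    rewrite mulrDr lerD// (le_trans (CauchySchwarz_enorm _ _))//
      ler_wpM2r ?enorm_ge0// XK1//.
      by rewrite normrN soft_sign_le1.
    exact: soft_sign_le1.
  rewrite RintegralZl//; last exact: (integrableD mO ieg iegphi).
  rewrite RintegralD// ler_pM2l// lerD2l ltW//.
  apply: le_lt_trans He; rewrite lerDr; exact: Rintegral_ge0.
have H2 : 1 - 2 * e <= \int[mu]_(x in Omega) f x.
  have iau : mu.-integrable Omega (EFin \o fun x => `|u x|) by exact: (integrable_norm iu).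
  have iaup : mu.-integrable Omega (EFin \o fun x => `|u x - phi x|).
    exact: (integrable_norm iuphi).
  have : \int[mu]_(x in Omega) (`|u x| - `|u x - phi x| - d) <= \int[mu]_(x in Omega) f x.
    apply: le_Rintegral => //.
      exact: (integrableB mO (integrableB mO iau iaup) ione).
    move=> x _; apply: le_trans (soft_abs_ge _ _).
    rewrite lerD2r lerBlDr -[in leLHS](subrK (phi x) (u x)) addrC.
    exact: ler_normD.
  apply: le_trans; rewrite RintegralB//; last exact: (integrableB mO iau iaup).
  rewrite RintegralB// u1 Rintegral_cst//.
  have dm : d * m <= e.
    rewrite /d -mulrA; apply: ler_piMr; first exact: ltW.
    by rewrite ler_pdivrMl ?ltr_pwDr// mulr1 lerDl.
  have ue : \int[mu]_(x in Omega) `|u x - phi x| <= e.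
    apply: ltW; apply: le_lt_trans He; rewrite lerDl Rintegral_ge0// => x _.
    exact: enorm_ge0.
  rewrite -/m; move: dm ue; set q := \int[mu]_(x in Omega) _; lra.
have H3 : c * (1 - 2 * e) <= K * (I + e) by apply: le_trans H1; rewrite ler_wpM2l.
have He2 : (K + 2 * c) * e <= eta.
  rewrite /e mulrCA; apply: ler_piMr; first exact: ltW.
  by rewrite ler_pdivrMr// mul1r lerDl.
rewrite mulrDr in H3; lra.
Qed.

End lower_bound.

Section upper_bound.
Context {R : realType} {n : nat}.
Local Notation mu := (lebesgue_rV R n).
Implicit Types (Omega : set 'rV[R]_n).

Lemma test_function_sobolev0 Omega (phi : 'rV[R]_n -> R) : measurable Omega ->
  test_function Omega phi -> sobolev11_0 Omega phi (grad phi).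
Proof.
move=> mO tphi; have [C1phi cphi phiO] := test_function_C1c tphi.
have [dphi pphi] := C1phi.
split; last first.
  move=> e e0; exists phi => //; rewrite /sobolev11_norm.
  under eq_Rintegral do rewrite subrr normr0.
  under [X in _ + X]eq_Rintegral do rewrite subrr enorm0.
  by rewrite !Rintegral_cst// !mul0r addr0.
split.
- apply: (integrable_compact mO cphi); first exact: C1_continuous.
  by move=> x; exact: tsupport0.
- move=> i; under eq_fun do rewrite mxE.
  by apply: (integrable_compact mO cphi) => // x; exact: partial_tsupport0.
- move=> psi tpsi i; have [C1psi cpsi psiO] := test_function_C1c tpsi.
  have [dpsi ppsi] := C1psi.
  have i1 : mu.-integrable Omega (EFin \o fun x => phi x * partial i psi x).
    apply: (integrable_compact mO cphi).
      by apply: continuous_mul => //; exact: C1_continuous.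
    by move=> x sx; rewrite tsupport0 ?mul0r.
  have i2 : mu.-integrable Omega (EFin \o fun x => grad phi x ord0 i * psi x).
    under eq_fun do rewrite mxE.
    apply: (integrable_compact mO cphi).
      by apply: continuous_mul => //; exact: C1_continuous.
    by move=> x sx; rewrite partial_tsupport0 ?mul0r.
  apply/eqP; rewrite -addr_eq0 -RintegralD//; apply/eqP.
  have := Rintegral_partial0 i mO (C1cM (And3 C1phi cphi phiO) C1psi).
  move=> <-; apply: eq_Rintegral => x _.
  by rewrite partialM// mxE [X in _ + X]mulrC.
Qed.

Lemma test_functionZ Omega (c : R) (phi : 'rV[R]_n -> R) :
  test_function Omega phi -> test_function Omega (fun x => c * phi x).
Proof.
move=> [sphi cphi phiO].
have ss : closure [set x | c * phi x != 0] `<=` closure [set x | phi x != 0].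
  by apply: closure_subset => x /=; apply: contra_neq => ->; rewrite mulr0.
split.
- by apply: smoothM => //; exact: smooth_cst.
- by apply: subclosed_compact cphi ss; exact: closed_closure.
- exact: subset_trans phiO.
Qed.

Lemma lambda1_le Omega u g : sobolev11_0 Omega u g ->
  \int[mu]_(x in Omega) `|u x| = 1 ->
  lambda1 Omega <= \int[mu]_(x in Omega) enorm (g x).
Proof.
move=> ug u1; apply: ge_inf; last by exists u, g.
exists 0 => l [u' [g' [_ _ ->]]]; apply: Rintegral_ge0 => x _; exact: enorm_ge0.
Qed.

(** The competitor is v divided by its integral: k times the integral of
    - X . grad v is k times the integral of v div X. *)
Lemma calibration_upper_bound Omega (X : 'rV[R]_n -> 'rV[R]_n) v (k c : R) :
  measurable Omega -> test_function Omega v -> (forall x, 0 <= v x) ->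
  0 < \int[mu]_(x in Omega) v x ->
  (forall i, C1 (fun x => X x ord0 i)) ->
  (forall x, Omega x -> divergence X x = c) ->
  (forall x, Omega x ->
     enorm (grad v x) <= k * - \sum_i X x ord0 i * partial i v x) ->
  exists u g, [/\ sobolev11_0 Omega u g, \int[mu]_(x in Omega) `|u x| = 1 &
    \int[mu]_(x in Omega) enorm (g x) <= k * c].
Proof.
move=> mO tv v0 I0 CX divX kX.
set I := \int[mu]_(x in Omega) v x in I0.
have Cv := test_function_C1c tv.
have [C1v cv vO] := Cv; have [dv pv] := C1v.
have iv : mu.-integrable Omega (EFin \o v).
  apply: (integrable_compact mO cv); first exact: C1_continuous.
  by move=> x; exact: tsupport0.
exists (fun x => I^-1 * v x), (grad (fun x => I^-1 * v x)); split.
- by apply: test_function_sobolev0 => //; exact: test_functionZ.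
- under eq_Rintegral do rewrite normrM !ger0_norm ?invr_ge0 ?(ltW I0)//.
  by rewrite RintegralZl// mulVf// gt_eqF.
have igv i : mu.-integrable Omega (EFin \o fun x => grad v x ord0 i).
  under eq_fun do rewrite mxE.
  by apply: (integrable_compact mO cv) => // x; exact: partial_tsupport0.
have iegv := integrable_enorm mO igv.
have gradE x : grad (fun x => I^-1 * v x) x = I^-1 *: grad v x.
  apply/rowP => i; rewrite !mxE (partialM i (differentiable_cst _ x) (dv x)).
  by rewrite partial_cst mulr0 addr0.
under eq_Rintegral do rewrite gradE enormZ ger0_norm ?invr_ge0 ?(ltW I0)//.
rewrite RintegralZl// ler_pdivrMl// mulrA mulrC mulrA [X in _ <= X]mulrC.
have iXv : mu.-integrable Omega (EFin \o fun x => \sum_i X x ord0 i * partial i v x).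
  apply: (integrable_compact mO cv).
    by apply: continuous_sum => i; apply: continuous_mul => //; exact: C1_continuous.
  by move=> x xf; rewrite big1// => i _; rewrite partial_tsupport0 ?mulr0.
have iNXv : mu.-integrable Omega (EFin \o fun x => - \sum_i X x ord0 i * partial i v x).
  exact: integrableN iXv.
have E : c * I = \int[mu]_(x in Omega) (- \sum_i X x ord0 i * partial i v x).
  under [RHS]eq_Rintegral do rewrite -mulN1r.
  rewrite RintegralZl// mulN1r -(divergence_theorem mO Cv CX) /I -RintegralZl//.
  by apply: eq_Rintegral => x /set_mem xO; rewrite divX// mulrC.
rewrite E -RintegralZl//; apply: le_Rintegral => //.
exact: (integrableZl mO k iNXv).
Qed.

End upper_bound.

(** * Bounds on a smooth field in a ball *)

Section field_bounds.
Context {R : realType} {n : nat}.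
Implicit Types (a x y s : 'rV[R]_n) (V : 'rV[R]_n -> 'rV[R]_n).

Lemma finite_bound m (F : 'I_m -> 'rV[R]_n -> R) a rho :
  (forall k, continuous (F k)) ->
  exists2 D, 0 < D & forall k x, `|a - x| <= rho -> `|F k x| <= D.
Proof.
move=> cF.
have /choice[M HM] k : exists M, 0 < M /\ forall x, `|a - x| <= rho -> `|F k x| <= M.
  by have [M M0 HM] := compact_ball_bounded a rho (cF k); exists M.
exists (1 + \sum_k M k) => [|k x xK].
  by rewrite ltr_pwDl// sumr_ge0// => k _; rewrite ltW//; exact: (HM k).1.
rewrite (le_trans ((HM k).2 x xK))// (bigD1 k)//= addrCA lerDl addr_ge0// sumr_ge0// => j _.
by rewrite ltW//; exact: (HM j).1.
Qed.

(** The segment from y to x stays in the ball, and the mean value theorem applies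
    on it. *)
Lemma mean_value_bound f a rho D x y : smooth f ->
  (forall j z, `|a - z| <= rho -> `|partial j f z| <= D) ->
  `|a - x| <= rho -> `|a - y| <= rho -> `|f x - f y| <= n%:R * D * `|x - y|.
Proof.
move=> sf fD xK yK.
pose h (s : R) := f (y + s *: (x - y)).
pose dh (s : R) := 'D_(x - y) f (y + s *: (x - y)).
have hdh (s : R) : is_derive s (1 : R) h (dh s).
  have : is_derive (y + s *: (x - y)) (x - y) f (dh s).
    by apply: derivableP; apply: diff_derivable; exact: smooth_diff.
  apply: is_derive_line => k; rewrite /h; congr f.
  by rewrite [k *: 1]mulr1 scalerDl addrCA addrA.
have ch : {within `[0, 1], continuous h}.
  apply: continuous_subspaceT => s; apply: differentiable_continuous.
  by apply/derivable1_diffP; have [] := hdh s.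
have [c] := @MVT_segment _ h dh 0 1 ler01 (fun w _ => hdh w) ch.
rewrite in_itv/= => /andP[c0 c1].
rewrite /h scale1r scale0r addr0 addrCA subrr addr0 subr0 mulr1 => ->.
rewrite /dh derive_sum_partial; last exact: smooth_diff.
have zK : `|a - (y + c *: (x - y))| <= rho.
  have -> : a - (y + c *: (x - y)) = (1 - c) *: (a - y) + c *: (a - x).
    by apply/rowP => i; rewrite !mxE; ring.
  rewrite (le_trans (ler_normD _ _))// !normrZ !ger0_norm ?subr_ge0//.
  rewrite -[leRHS]mul1r -[X in _ <= X * _](subrK c) [leRHS]mulrDl.
  by rewrite lerD// ler_wpM2l// subr_ge0.
apply: (le_trans (ler_norm_sum _ _ _)).
rewrite (@le_trans _ _ (\sum_(i < n) `|x - y| * D))//.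
  apply: ler_sum => i _; rewrite normrM ler_pM//; first exact: coord_le_norm.
  exact: fD.
by rewrite sumr_const card_ord -[leLHS]mulr_natl mulrAC -mulrA.
Qed.

Lemma norm_le_coord x (e : R) : 0 <= e -> (forall i, `|x ord0 i| <= e) -> `|x| <= e.
Proof.
move=> e0 h; rewrite [leLHS]mx_normrE; apply: bigmax_le => // -[i j] _ /=.
by rewrite (ord1 i).
Qed.

(** If D bounds V and its partial derivatives coordinatewise in the ball, each
    of the four bounds holds with n D or n ^ 2 D.  The constant is taken larger
    than both and positive in every dimension. *)
Lemma field_bounds V a rho : smooth_field V ->
  exists2 L, 0 < L &
  [/\ forall x, `|a - x| <= rho -> enorm (V x) <= L,
      forall x y, `|a - x| <= rho -> `|a - y| <= rho -> `|V x - V y| <= L * `|x - y|,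
      forall x y, `|a - x| <= rho -> `|a - y| <= rho ->
        enorm (V x - V y) <= L * enorm (x - y) &
      forall x s, `|a - x| <= rho ->
        enorm (\row_j \sum_i s ord0 i * partial j (fun z => V z ord0 i) x) <= L * enorm s].
Proof.
move=> sV.
have [D1 D10 HD1] := @finite_bound n (fun i x => V x ord0 i) a rho
  (fun i => smooth_continuous (sV i)).
have /choice[D2 HD2] i : exists D, 0 < D /\
    forall j x, `|a - x| <= rho -> `|partial j (fun z => V z ord0 i) x| <= D.
  have [j|D D0 HD] := @finite_bound n (fun j => partial j (fun z => V z ord0 i)) a rho.
    by apply: smooth_continuous; exact: smooth_partial.
  by exists D.
pose D := D1 + \sum_i D2 i.
have D20 : 0 <= \sum_i D2 i by apply: sumr_ge0 => i _; rewrite ltW//; exact: (HD2 i).1.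
have D0 : 0 < D by rewrite ltr_wpDr.
have VD i x : `|a - x| <= rho -> `|V x ord0 i| <= D.
  by move=> xK; rewrite (le_trans (HD1 _ _ xK))// lerDl.
have PD i j x : `|a - x| <= rho -> `|partial j (fun z => V z ord0 i) x| <= D.
  move=> xK; rewrite (le_trans ((HD2 i).2 _ _ xK))// /D (bigD1 i)//= addrCA lerDl.
  by rewrite addr_ge0 ?(ltW D10)// sumr_ge0// => k _; rewrite ltW//; exact: (HD2 k).1.
have Vl x y : `|a - x| <= rho -> `|a - y| <= rho -> `|V x - V y| <= n%:R * D * `|x - y|.
  move=> xK yK; apply: norm_le_coord; first by rewrite !mulr_ge0// ltW.
  move=> i; rewrite !mxE.
  exact: (mean_value_bound (sV i) (PD i) xK yK).
have n1 : (n%:R : R) <= n%:R + 1 by rewrite lerDl.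
have n0 : 0 <= n%:R :> R by [].
pose L := (n%:R + 1) * ((n%:R + 1) * D).
have nDL : n%:R * D <= L.
  rewrite /L mulrA ler_wpM2r ?ltW//; nra.
have nnDL : n%:R * (n%:R * D) <= L.
  rewrite /L !mulrA ler_wpM2r ?ltW//; nra.
exists L; first by rewrite !mulr_gt0// ltr_wpDl.
split.
- move=> x xK; apply: le_trans (enorm_le_sum _) _; apply: le_trans nDL.
  rewrite (@le_trans _ _ (\sum_(i < n) D))//.
    by apply: ler_sum => i _; exact: VD.
  by rewrite sumr_const card_ord -[leLHS]mulr_natl.
- by move=> x y xK yK; apply: le_trans (Vl _ _ xK yK) _; rewrite ler_wpM2r.
- move=> x y xK yK; apply: le_trans (enorm_le_norm _) _.
  apply: (@le_trans _ _ (n%:R * (n%:R * D * enorm (x - y)))).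
    rewrite ler_wpM2l// (le_trans (Vl _ _ xK yK))// ler_wpM2l ?norm_le_enorm//.
    by rewrite mulr_ge0// ltW.
  by rewrite mulrA ler_wpM2r ?enorm_ge0.
- move=> x s xK; apply: le_trans (enorm_le_sum _) _.
  apply: (@le_trans _ _ (n%:R * (n%:R * D) * enorm s)); last first.
    by rewrite ler_wpM2r ?enorm_ge0.
  rewrite (@le_trans _ _ (\sum_(j < n) n%:R * D * enorm s))//; last first.
    by rewrite sumr_const card_ord -[leLHS]mulr_natl mulrA.
  apply: ler_sum => j _; rewrite mxE (le_trans (ler_norm_sum _ _ _))//.
  rewrite (@le_trans _ _ (\sum_(i < n) D * enorm s))//; last first.
    by rewrite sumr_const card_ord -[leLHS]mulr_natl mulrA.
  apply: ler_sum => i _; rewrite normrM mulrC ler_pM ?coord_le_enorm//.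
  exact: PD.
Qed.

End field_bounds.

(** * The calibrating field *)

Section radial_field.
Context {R : realType} {n : nat}.
Implicit Types (a x y : 'rV[R]_n) (V : 'rV[R]_n -> 'rV[R]_n) (r t tau L : R).

(** Up to O(t ^ 2), the position relative to a of the preimage of y under
    perturbation V t. *)
Definition radial_field a V t y : 'rV[R]_n := y - a - t *: V y.

Lemma radial_fieldE a V t y i :
  radial_field a V t y ord0 i = y ord0 i - a ord0 i - t * V y ord0 i.
Proof. by rewrite !mxE. Qed.

Lemma smooth_radial_field a V t i : smooth_field V ->
  smooth (fun y => radial_field a V t y ord0 i).
Proof.
move=> sV; under eq_fun do rewrite radial_fieldE.
apply: smoothB; first by apply: smoothB; [exact: smooth_coord|exact: smooth_cst].
by apply: smoothM; [exact: smooth_cst|exact: sV].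
Qed.

Lemma partial_radial_field a V t i j x : smooth_field V ->
  partial j (fun y => radial_field a V t y ord0 i) x =
  (i == j)%:R - t * partial j (fun z => V z ord0 i) x.
Proof.
move=> sV; under eq_fun do rewrite radial_fieldE.
have dx : differentiable (fun y : 'rV[R]_n => y ord0 i) x.
  by apply: smooth_diff; exact: smooth_coord.
have dc (c : R) : differentiable (fun _ : 'rV[R]_n => c) x.
  by apply: smooth_diff; exact: smooth_cst.
have dV : differentiable (fun y : 'rV[R]_n => V y ord0 i) x by exact: smooth_diff.
rewrite (@partialB _ _ j (fun y => y ord0 i - a ord0 i) (fun y => t * V y ord0 i)).
- rewrite (partialB j dx (dc _)) (partialM j (dc t) dV).
  by rewrite !partial_cst subr0 mulr0 addr0 partial_coord.
- by apply: differentiableB.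
- by apply: differentiableM.
Qed.

Lemma divergence_radial_field a V t x : smooth_field V -> divergence V x = 0 ->
  divergence (radial_field a V t) x = n%:R.
Proof.
move=> sV dV; rewrite /divergence.
under eq_bigr do rewrite partial_radial_field//.
rewrite big_split/= sumrN -mulr_sumr -/(divergence V x) dV mulr0 subr0.
by under eq_bigr do rewrite eqxx; rewrite sumr_const card_ord.
Qed.

Lemma smooth_radial_field_sqr a V t : smooth_field V ->
  smooth (fun y => enorm (radial_field a V t y) ^+ 2).
Proof.
move=> sV; under eq_fun do rewrite enorm_sqr.
by apply: smooth_sum => i; apply: smoothM; exact: smooth_radial_field.
Qed.

Lemma grad_radial_field_sqr a V t x : smooth_field V ->
  grad (fun y => enorm (radial_field a V t y) ^+ 2) x =
  2 *: (radial_field a V t x - t *: \row_j \sum_i radial_field a V t x ord0 i *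
          partial j (fun z => V z ord0 i) x).
Proof.
move=> sV; apply/rowP => j; rewrite [LHS]mxE.
have dS i : differentiable (fun y => radial_field a V t y ord0 i) x.
  by apply: smooth_diff; exact: smooth_radial_field.
under eq_fun do rewrite enorm_sqr.
rewrite (@partial_sum _ _ j n (fun i y => radial_field a V t y ord0 i ^+ 2)); last first.
  by move=> k; apply: differentiableM.
under eq_bigr => i _ do
  rewrite (partialM j (dS i) (dS i)) (partial_radial_field a t i j x sV) -mulr2n mulrBr.
rewrite sumrMnl -[LHS]mulr_natl [RHS]mxE [X in _ = 2 * X]mxE; congr (_ * _).
rewrite big_split/=; congr (_ + _).
  rewrite (bigD1 j)//= eqxx mulr1 big1 ?addr0// => i ij.
  by rewrite (negbTE ij) mulr0.
rewrite sumrN [RHS]mxE [X in _ = - X]mxE [X in _ = - (t * X)]mxE mulr_sumr.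
by congr (- _); apply: eq_bigr => i _; rewrite mulrCA.
Qed.

(** S makes an angle O(tau L) with S - t W, so the loss in the Cauchy-Schwarz
    inequality is quadratic in tau.  Precisely,
    |S|^2 |S - t W|^2 - (S . (S - t W))^2 = t^2 (|S|^2 |W|^2 - (S . W)^2)
    is at most (tau L)^2 |S|^4, while S . (S - t W) >= |S|^2 / 2. *)
Lemma angle_bound (S W : 'rV[R]_n) t tau L m : 0 < m -> m <= enorm S ->
  `|t| <= tau -> 0 <= L -> tau * L <= 2^-1 -> enorm W <= L * enorm S ->
  enorm (S - t *: W) <=
  (1 + 4 * (tau * L) ^+ 2) / m * \sum_i S ord0 i * (S - t *: W) ord0 i.
Proof.
move=> m0 mS ttau L0 tauL WL.
set s := enorm S in mS WL *; set w := enorm W in WL.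
have s0 : 0 < s by exact: lt_le_trans mS.
have w0 : 0 <= w by exact: enorm_ge0.
pose p := \sum_i S ord0 i * W ord0 i.
set d := \sum_i _; set N := enorm _.
have N0 : 0 <= N by exact: enorm_ge0.
have dE : d = s ^+ 2 - t * p.
  rewrite enorm_sqr /p mulr_sumr -sumrB; apply: eq_bigr => i _.
  by rewrite !mxE; ring.
have NE : N ^+ 2 = s ^+ 2 - 2 * t * p + t ^+ 2 * w ^+ 2.
  rewrite !enorm_sqr /p !mulr_sumr -sumrB -big_split; apply: eq_bigr => i _ /=.
  by rewrite !mxE; ring.
have pw : `|p| <= s * w.
  rewrite ler_norml CauchySchwarz_enorm andbT lerNl.
  have := CauchySchwarz_enorm (- S) W.
  rewrite -scaleN1r enormZ normrN1 mul1r; apply: le_trans.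
  rewrite -sumrN le_eqVlt; apply/orP; left; apply/eqP.
  by apply: eq_bigr => i _; rewrite !mxE; ring.
have tau0 : 0 <= tau by exact: le_trans ttau.
have twl : `|t| * w <= tau * L * s.
  by rewrite -mulrA ler_pM.
have tp : `|t * p| <= tau * L * s ^+ 2.
  rewrite normrM (@le_trans _ _ (`|t| * (s * w)))//; first by rewrite ler_wpM2l.
  by rewrite mulrCA expr2 [leRHS]mulrCA ler_wpM2l// ltW.
have dge : s ^+ 2 / 2 <= d.
  have : tau * L * s ^+ 2 <= 2^-1 * s ^+ 2 by rewrite ler_wpM2r ?sqr_ge0.
  have := le_trans (ler_norm _) tp; rewrite dE; lra.
have d0 : 0 < d by rewrite (lt_le_trans _ dge)// divr_gt0 ?exprn_gt0.
set k := tau * L in twl tp tauL *.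
have k0 : 0 <= k by rewrite mulr_ge0.
have NN : (N * s) ^+ 2 <= ((1 + 4 * k ^+ 2) * d) ^+ 2.
  have -> : (N * s) ^+ 2 = d ^+ 2 + t ^+ 2 * (w ^+ 2 * s ^+ 2 - p ^+ 2).
    by rewrite exprMn NE dE; ring.
  have H1 : t ^+ 2 * w ^+ 2 <= (k * s) ^+ 2.
    rewrite -exprMn -[leLHS]real_normK ?num_real// normrM (ger0_norm w0).
    by rewrite ler_pXn2r// nnegrE ?mulr_ge0// ltW.
  have H2 : t ^+ 2 * (w ^+ 2 * s ^+ 2 - p ^+ 2) <= k ^+ 2 * (s ^+ 2) ^+ 2.
    rewrite (@le_trans _ _ (t ^+ 2 * w ^+ 2 * s ^+ 2))//.
      by rewrite -mulrA ler_wpM2l ?sqr_ge0// gerBl sqr_ge0.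
    rewrite (@le_trans _ _ ((k * s) ^+ 2 * s ^+ 2))//; first by rewrite ler_wpM2r ?sqr_ge0.
    by rewrite le_eqVlt; apply/orP; left; apply/eqP; ring.
  have H3 : (s ^+ 2) ^+ 2 <= (2 * d) ^+ 2.
    have d20 : 0 <= 2 * d by rewrite mulr_ge0// ltW.
    by rewrite ler_pXn2r ?nnegrE ?sqr_ge0//; move: dge; lra.
  have H4 : k ^+ 2 * (s ^+ 2) ^+ 2 <= 4 * k ^+ 2 * d ^+ 2.
    rewrite (le_trans (ler_wpM2l (sqr_ge0 k) H3))//.
    by rewrite le_eqVlt; apply/orP; left; apply/eqP; ring.
  rewrite [leRHS]exprMn.
  have k2 : 0 <= k ^+ 2 by exact: sqr_ge0.
  have d2 : 0 <= d ^+ 2 by exact: sqr_ge0.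
  have : (1 + 4 * k ^+ 2) * d ^+ 2 <= (1 + 4 * k ^+ 2) ^+ 2 * d ^+ 2.
    by rewrite ler_wpM2r// expr2 ler_peMl//; lra.
  have := le_trans H2 H4; lra.
have Ns : N * s <= (1 + 4 * k ^+ 2) * d.
  have Ns0 : 0 <= N * s by rewrite mulr_ge0// ltW.
  have kd0 : 0 <= (1 + 4 * k ^+ 2) * d.
    by rewrite mulr_ge0 ?(ltW d0)// addr_ge0// mulr_ge0// sqr_ge0.
  by move: NN; rewrite ler_pXn2r// nnegrE.
rewrite mulrAC ler_pdivlMr//; apply: le_trans Ns.
by rewrite ler_wpM2l.
Qed.

Lemma continuous_rV (T : topologicalType) m (F : T -> 'rV[R]_m) :
  (forall i, continuous (fun z : T => F z ord0 i)) -> continuous F.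
Proof.
move=> cF x A /nbhs_ballP[e /= e0 eA].
have : \forall z \near x, forall i, `|F x ord0 i - F z ord0 i| < e.
  apply: filter_forall => i.
  by have /cvgrPdist_lt/(_ e e0) := cF i x.
by apply: filterS => z Fz; apply: eA; exact/ball_rVE.
Qed.

(** The open ball is a countable union of compact sets, hence so is its
    continuous image. *)
Lemma measurable_perturbation V t a r : smooth_field V ->
  measurable (perturbation V t @` eball a r).
Proof.
move=> sV.
pose K (k : nat) := [set x | enorm (x - a) <= r - k.+1%:R^-1].
have -> : eball a r = \bigcup_k K k.
  apply/seteqP; split => [x xr|x [k _]].
    have xr0 : 0 < r - enorm (x - a) by rewrite subr_gt0.
    have [k _ /(_ k (leqnn _)) /= hk] := near_infty_natSinv_lt (PosNum xr0).
    by exists k => //; rewrite /K /= lerBrDr -lerBrDl ltW.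
  rewrite /K/= => /le_lt_trans; apply; by rewrite ltrBlDr ltrDl invr_gt0.
rewrite image_bigcup; apply: bigcupT_measurable => k.
apply: closed_measurable_rV; apply: compact_closed; first exact: norm_hausdorff.
apply: continuous_compact.
  apply: continuous_subspaceT; apply: continuous_rV => i.
  rewrite /perturbation; under eq_fun do rewrite !mxE.
  apply: continuous_add; first exact: coord_continuous.
  by apply: continuous_mul; [exact: cst_continuous|exact: smooth_continuous].
have cd : continuous (fun x => enorm (x - a)).
  have cs : continuous (fun x => x - a).
    apply: continuous_rV => i; under eq_fun do rewrite !mxE.
    by apply: continuous_add; [exact: coord_continuous|exact: cst_continuous].
  by move=> x; exact: (continuous_comp (cs x) (@continuous_enorm R n _)).
apply: subclosed_compact (@compact_closed_ball_rV R n a r) _.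
  apply: (preimage_closed (D := [set z | z <= r - k.+1%:R^-1])).
    by move=> x _; exact: cd.
  exact: closed_le.
move=> x; rewrite /K /closed_ball_/= distrC => /(le_trans (norm_le_enorm _)).
by move=> /le_trans; apply; rewrite gerBl invr_ge0.
Qed.

End radial_field.

(** * The perturbed ball *)

(** The fixed point theorem below needs completeness and norm in one structure. *)
HB.instance Definition _ (R : realType) (m n : nat) := Complete.on 'M[R]_(m, n).

Section geometry.
Context {R : realType} {n : nat}.
Variables (V : 'rV[R]_n -> 'rV[R]_n) (a : 'rV[R]_n) (r L t tau : R).
(* All points under consideration lie in the sup-norm ball of radius r + 3
   about a, where the perturbation moves points by at most tau * L. *)
Hypothesis L0 : 0 < L.
Hypothesis enormV : forall x, `|a - x| <= r + 3 -> enorm (V x) <= L.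
Hypothesis lipV : forall x y, `|a - x| <= r + 3 -> `|a - y| <= r + 3 ->
  `|V x - V y| <= L * `|x - y|.
Hypothesis elipV : forall x y, `|a - x| <= r + 3 -> `|a - y| <= r + 3 ->
  enorm (V x - V y) <= L * enorm (x - y).
Hypothesis ttau : `|t| <= tau.
Hypothesis tauL : tau * L <= 2^-1.

Let tau0 : 0 <= tau.
Proof. exact: le_trans ttau. Qed.

Let etV x : `|a - x| <= r + 3 -> enorm (t *: V x) <= tau * L.
Proof. by move=> xK; rewrite enormZ ler_pM ?enorm_ge0 ?enormV. Qed.

Let ntV x : `|a - x| <= r + 3 -> `|t *: V x| <= 2^-1.
Proof.
by move=> xK; rewrite (le_trans (norm_le_enorm _))// (le_trans (etV xK)).
Qed.

Let ball_K x : eball a r x -> `|a - x| <= r.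
Proof. by move=> xr; rewrite distrC (le_trans (norm_le_enorm _))// ltW. Qed.

Lemma image_near y : (perturbation V t @` eball a r) y -> `|a - y| <= r + 1.
Proof.
move=> [x /ball_K xr <-]; rewrite /perturbation opprD addrA.
rewrite (le_trans (ler_normB _ _))// lerD//.
rewrite (le_trans (ntV _))//; first by rewrite (le_trans xr)// lerDl.
lra.
Qed.

(** At the image of x the field is x - a + t (V x - V (x + t V x)): the terms of
    first order in t cancel. *)
Lemma radial_field_image_le y : (perturbation V t @` eball a r) y ->
  enorm (radial_field a V t y) <= r + (tau * L) ^+ 2.
Proof.
move=> iy; have yK := image_near iy.
move: iy yK => [x xr <-]; set z := perturbation V t x => yr.
have xK : `|a - x| <= r + 3 by rewrite (le_trans (ball_K xr))// lerDl.
have yK : `|a - z| <= r + 3 by rewrite (le_trans yr)// lerD2l; lra.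
have -> : radial_field a V t z = (x - a) + t *: (V x - V z).
  by rewrite /radial_field {1}/z /perturbation; apply/rowP => i; rewrite !mxE; ring.
apply: le_trans (enormD _ _) _; apply: lerD; first exact: ltW.
rewrite enormZ expr2 (@le_trans _ _ (tau * (L * (tau * L))))//; last by rewrite mulrA.
rewrite ler_pM ?enorm_ge0// (le_trans (elipV xK yK))// ler_wpM2l ?(ltW L0)//.
have -> : x - z = (- t) *: V x.
  by rewrite /z /perturbation; apply/rowP => i; rewrite !mxE; ring.
by rewrite enormZ normrN -enormZ; exact: etV.
Qed.

(** The preimage of y is the fixed point of x |-> y - t V x, which is a
    contraction of a small ball about y. *)
Lemma radial_field_le_image y : `|a - y| <= r + 2 ->
  enorm (radial_field a V t y) + (tau * L) ^+ 2 < r ->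
  (perturbation V t @` eball a r) y.
Proof.
move=> yr Sy.
pose U := closed_ball_ (Num.norm : 'rV[R]_n -> R) y 2^-1.
have UK x : U x -> `|a - x| <= r + 3.
  rewrite /U /closed_ball_/= => yx.
  have -> : a - x = (a - y) + (y - x) by rewrite addrA subrK.
  by rewrite (le_trans (ler_normD _ _))//; lra.
have Uf : set_fun U U (fun x => y - t *: V x).
  by move=> x /UK xK; rewrite /U /closed_ball_/= subKr; exact: ntV.
have tL0 : 0 <= tau * L by rewrite mulr_ge0// ltW.
have [|||x Ux xE] := @banach_fixed_point R 'rV[R]_n U (mkfun_fun Uf).
- exists (NngNum tL0); split => /=; first by rewrite (le_lt_trans tauL)// invf_lt1// ltr1n.
  move=> [x z] [/= /UK xK /UK zK].
  rewrite /= /mkfun.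
  have -> : y - t *: V x - (y - t *: V z) = t *: (V z - V x).
    by apply/rowP => i; rewrite !mxE; ring.
  rewrite normrZ [`|x - z|]distrC -mulrA ler_pM// lipV//.
- exact: closed_closed_ball_.
- by exists y; rewrite /U /closed_ball_/= subrr normr0 invr_ge0.
have {}xE : x = y - t *: V x by [].
exists x; last by rewrite /perturbation {1}xE subrK.
have xK := UK _ Ux.
have yK : `|a - y| <= r + 3 by rewrite (le_trans yr)// lerD2l; lra.
rewrite /eball/=; apply: le_lt_trans Sy.
have -> : x - a = radial_field a V t y + t *: (V y - V x).
  by rewrite {1}xE /radial_field; apply/rowP => i; rewrite !mxE; ring.
rewrite (le_trans (enormD _ _))// lerD2l enormZ expr2.
rewrite (@le_trans _ _ (tau * (L * (tau * L))))//; last by rewrite mulrA.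
rewrite ler_pM ?enorm_ge0// (le_trans (elipV yK xK))// ler_wpM2l ?(ltW L0)//.
have -> : y - x = t *: V x by rewrite {1}xE subKr.
exact: etV.
Qed.

(** This keeps the support of the cutoff of |radial_field|^2 away from the edge of
    the region where V is controlled. *)
Lemma radial_field_far y : r + 1 <= `|a - y| -> `|a - y| <= r + 3 ->
  r + 2^-1 <= enorm (radial_field a V t y).
Proof.
move=> ry yK.
have := enormD (radial_field a V t y) (t *: V y); rewrite /radial_field subrK.
have := norm_le_enorm (y - a); rewrite distrC.
have := etV yK; move: ry tauL; lra.
Qed.

Lemma radial_field_near (y : 'rV[R]_n) : `|a - y| <= r + 3 ->
  enorm (radial_field a V t y) <= n%:R * `|a - y| + tau * L.
Proof.
move=> yK; rewrite /radial_field (le_trans (enormD _ _))// lerD//.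
  by rewrite distrC enorm_le_norm.
by rewrite -scaleN1r enormZ normrN1 mul1r etV.
Qed.

Hypothesis sV : smooth_field V.
Hypothesis divV : forall x, divergence V x = 0.
Hypothesis jacV : forall x (s : 'rV[R]_n), `|a - x| <= r + 3 ->
  enorm (\row_j \sum_i s ord0 i * partial j (fun z => V z ord0 i) x) <= L * enorm s.
Hypothesis r0 : 0 < r.

Local Notation mu := (lebesgue_rV R n).
Local Notation Omega := (perturbation V t @` eball a r).

Lemma image_lower_bound u g : sobolev11_0 Omega u g ->
  \int[mu]_(x in Omega) `|u x| = 1 ->
  n%:R / (r + (tau * L) ^+ 2) <= \int[mu]_(x in Omega) enorm (g x).
Proof.
apply: (@calibration_lower_bound _ _ _ (radial_field a V t)).
- exact: measurable_perturbation.
- have r20 : 0 < r + 2 by rewrite addr_gt0.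
  apply: (@le_lt_trans _ _ (mu (ball a (r + 2)))).
    apply: le_measure; rewrite ?inE.
    + exact: measurable_perturbation.
    + exact: measurable_ball_rV.
    + move=> y /image_near yr; rewrite -ball_normE /=.
      by rewrite (le_lt_trans yr)// ltrD2l ltr1n.
  by rewrite [X in (X < _)%E](lebesgue_rV_ball a r20) ltry.
- by rewrite ltr_pwDl// sqr_ge0.
- by [].
- by move=> i; apply: smooth_C1; exact: smooth_radial_field.
- by move=> x _; apply: divergence_radial_field.
- exact: radial_field_image_le.
Qed.

Variable delta : R.
Hypothesis ltdelta : (tau * L) ^+ 2 < delta.
Hypothesis deltar : 4 * delta <= r.
Hypothesis tauLr : 4 * (tau * L) <= r.

Local Notation A := ((r - 2 * delta) ^+ 2).
Local Notation B := ((r - delta) ^+ 2).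
Local Notation q := (fun y => enorm (radial_field a V t y) ^+ 2).

(** V is not controlled at infinity, where the radial field may be small again;
    the function is therefore set to 0 beyond the sup-norm distance r + 2, and
    it already vanishes from the distance r + 1 on. *)
Definition boundary_layer (y : 'rV[R]_n) : R :=
  if `|a - y| < r + 2 then cutoff A B (enorm (radial_field a V t y) ^+ 2) else 0.

Let delta0 : 0 < delta.
Proof. by rewrite (le_lt_trans _ ltdelta)// sqr_ge0. Qed.

Let AB : A < B.
Proof. by rewrite ltr_pXn2r// ?nnegrE; move: delta0 deltar; lra. Qed.

Let q_far y : r + 1 <= `|a - y| -> `|a - y| <= r + 3 -> B <= q y.
Proof.
move=> ry yK; have := radial_field_far ry yK.
by rewrite ler_pXn2r// ?nnegrE ?enorm_ge0//; move: delta0 deltar; lra.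
Qed.

Lemma boundary_layer_near y : `|a - y| < r + 2 ->
  \near y, boundary_layer y = cutoff A B (q y).
Proof.
move=> yr; have : nbhs y (ball a (r + 2)).
  apply: open_nbhs_nbhs; split; first exact: ball_open.
  by rewrite -ball_normE.
by apply: filterS => z; rewrite -ball_normE /boundary_layer/= => ->.
Qed.

Lemma boundary_layer_far y : r + 2 <= `|a - y| -> \near y, boundary_layer y = 0.
Proof.
move=> ry; have : nbhs y (ball y 1) by exact: nbhsx_ballx.
apply: filterS => z; rewrite -ball_normE/= => yz; rewrite /boundary_layer.
case: ifPn => // zr; apply: cutoff_eq0 => //; apply: q_far; last first.
  by rewrite ltW// (lt_le_trans zr)// lerD2l; lra.
have := ler_normD (a - z) (z - y).
rewrite addrA subrK [`|z - y|]distrC; move: ry yz; lra.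
Qed.

Lemma smooth_boundary_layer : smooth boundary_layer.
Proof.
apply: smooth_near => y; have [yr|yr] := ltP `|a - y| (r + 2).
  exists (fun y => cutoff A B (q y)); last exact: boundary_layer_near.
  by apply: smooth_cutoff; exact: smooth_radial_field_sqr.
by exists (fun=> 0); [exact: smooth_cst|exact: boundary_layer_far].
Qed.

Lemma test_function_boundary_layer : test_function Omega boundary_layer.
Proof.
pose F := closed_ball_ (Num.norm : 'rV[R]_n -> R) a (r + 2) `&`
  (q @^-1` [set z | z <= B]).
have cF : closed F.
  apply: closedI; first exact: closed_closed_ball_.
  apply: preimage_closed; last exact: closed_le.
  by move=> x _; apply: smooth_continuous; exact: smooth_radial_field_sqr.
have suppF : closure [set y | boundary_layer y != 0] `<=` F.
  rewrite [X in _ `<=` X]((closure_id F).1 cF); apply: closure_subset => y /=.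
  rewrite /boundary_layer; case: ifPn => [yr|]; last by rewrite eqxx.
  move=> qy; split; first exact: ltW.
  by rewrite /= leNgt; apply: contra qy => /ltW Bq; rewrite cutoff_eq0.
split; first exact: smooth_boundary_layer.
  apply: subclosed_compact (@compact_closed_ball_rV R n a (r + 2)) _.
    exact: closed_closure.
  by move=> y /suppF[].
move=> y /suppF[/= yr qB]; apply: radial_field_le_image => //.
have : enorm (radial_field a V t y) <= r - delta.
  move: qB; rewrite ler_pXn2r// ?nnegrE ?enorm_ge0//.
  by move: delta0 deltar; lra.
by move: ltdelta; lra.
Qed.

(** Where the cutoff varies, the radial field S has norm at least r - 2 delta,
    and the gradient of |S|^2 is 2 (S - t W) with W the transposed Jacobian of V
    applied to S. *)
Lemma boundary_layer_grad_bound y : Omega y ->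
  enorm (grad boundary_layer y) <= (1 + 4 * (tau * L) ^+ 2) / (r - 2 * delta) *
    - \sum_i radial_field a V t y ord0 i * partial i boundary_layer y.
Proof.
move=> Oy; have yr := image_near Oy.
have yK : `|a - y| <= r + 3 by rewrite (le_trans yr)// lerD2l; lra.
set S := radial_field a V t y.
set W := \row_j \sum_i S ord0 i * partial j (fun z => V z ord0 i) y.
set c := cutoff_deriv A B (enorm S ^+ 2).
have gradE : grad boundary_layer y = (2 * c) *: (S - t *: W).
  rewrite mulrC -scalerA -grad_radial_field_sqr//.
  apply/rowP => i; rewrite [RHS]mxE [LHS]mxE [grad _ _ _ _]mxE.
  rewrite (@partial_near _ _ i _ (cutoff A B \o q)).
    apply: partial_comp; first by apply: smooth_diff; exact: smooth_radial_field_sqr.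
    exact: is_derive_cutoff.
  by apply: boundary_layer_near; rewrite (le_lt_trans yr)// ltrD2l ltr1n.
have -> : \sum_i S ord0 i * partial i boundary_layer y =
    (2 * c) * \sum_i S ord0 i * (S - t *: W) ord0 i.
  rewrite mulr_sumr; apply: eq_bigr => i _.
  have -> : partial i boundary_layer y = grad boundary_layer y ord0 i by rewrite mxE.
  by rewrite gradE [X in _ * X = _]mxE mulrCA.
rewrite gradE enormZ.
have c0 : 2 * c <= 0 by rewrite pmulr_rle0// cutoff_deriv_le0.
have [qA|qA] := ltP (enorm S ^+ 2) A.
  by rewrite /c cutoff_deriv_eq0 ?(ltW qA)// mulr0 normr0 !mul0r oppr0 mulr0.
rewrite (ler0_norm c0).
have -> z : - (2 * c * z) = - (2 * c) * z by rewrite mulNr.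
rewrite [leRHS]mulrCA.
apply: ler_wpM2l; first by rewrite oppr_ge0.
have m0 : 0 < r - 2 * delta by move: r0 deltar; lra.
apply: angle_bound => //.
- by move: qA; rewrite ler_pXn2r// ?nnegrE ?enorm_ge0// ltW.
- exact: ltW.
- exact: jacV.
Qed.

Lemma boundary_layer_ge0 y : 0 <= boundary_layer y.
Proof. by rewrite /boundary_layer; case: ifP => // _; exact: cutoff_ge0. Qed.

Lemma boundary_layer_int_gt0 : 0 < \int[mu]_(x in Omega) boundary_layer x.
Proof.
pose e := r / (4 * (n%:R + 1)).
have n1 : 0 < n%:R + 1 :> R by rewrite ltr_wpDl.
have e0 : 0 < e by rewrite divr_gt0// mulr_gt0.
have er : e <= r.
  rewrite ler_pdivrMr ?mulr_gt0// ler_peMr ?(ltW r0)//.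
  have : 0 <= n%:R :> R by []. lra.
have ne : n%:R * e <= r / 4.
  rewrite /e mulrA ler_pdivrMr ?mulr_gt0//.
  have -> : r / 4 * (4 * (n%:R + 1)) = n%:R * r + r by field.
  by rewrite lerDl ltW.
have boundary_layerE x : ball a e x -> boundary_layer x = flat 1 1.
  rewrite -ball_normE/= => xe.
  have xr : `|a - x| < r + 2 by rewrite (lt_le_trans xe)// (le_trans er)// lerDl.
  rewrite /boundary_layer xr cutoff_cst// ler_pXn2r// ?nnegrE ?enorm_ge0//; last first.
    by move: r0 deltar; lra.
  have xK : `|a - x| <= r + 3 by rewrite (le_trans (ltW xr))// lerD2l; lra.
  have := radial_field_near xK.
  have : n%:R * `|a - x| <= n%:R * e by rewrite ler_wpM2l// ltW.
  by move: ne deltar tauLr; lra.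
have [sl cl lO] := test_function_boundary_layer.
have ballO : ball a e `<=` Omega.
  move=> x xe; apply: lO; apply: subset_closure => /=.
  by rewrite boundary_layerE// gt_eqF// flat1_gt0.
have mO := measurable_perturbation t a r sV.
have il : mu.-integrable Omega (EFin \o boundary_layer).
  apply: (integrable_compact mO cl); first exact: smooth_continuous.
  by move=> x; exact: tsupport0.
have mb := measurable_ball_rV a e.
have OE : Omega = ball a e `|` (Omega `\` ball a e) by rewrite setDUK.
rewrite OE Rintegral_setU//; last 3 first.
- exact: measurableD.
- by rewrite -OE.
- by apply/disj_setPS => x [xb [_ /(_ xb)]].
rewrite ltr_pwDl//; last by apply: Rintegral_ge0 => x _; exact: boundary_layer_ge0.
rewrite (@eq_Rintegral _ _ _ _ _ (fun=> flat 1 1)); last first.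
  by move=> x /set_mem; exact: boundary_layerE.
rewrite Rintegral_cst// mulr_gt0 ?flat1_gt0//.
by rewrite [X in fine X](lebesgue_rV_ball a e0)/= exprn_gt0// mulrn_wgt0.
Qed.

Lemma image_upper_bound : exists u g, [/\ sobolev11_0 Omega u g,
  \int[mu]_(x in Omega) `|u x| = 1 &
  \int[mu]_(x in Omega) enorm (g x) <=
    (1 + 4 * (tau * L) ^+ 2) / (r - 2 * delta) * n%:R].
Proof.
apply: (@calibration_upper_bound _ _ _ (radial_field a V t) boundary_layer).
- exact: measurable_perturbation.
- exact: test_function_boundary_layer.
- exact: boundary_layer_ge0.
- exact: boundary_layer_int_gt0.
- by move=> i; apply: smooth_C1; exact: smooth_radial_field.
- by move=> x _; apply: divergence_radial_field.
- exact: boundary_layer_grad_bound.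
Qed.

End geometry.

(** * The eigenvalue to first order *)

(** The bound is in terms of any tau >= |t| rather than of |t|, so that it also
    controls the eigenvalue at t = 0, with a positive width of the boundary
    layer. *)
Lemma lambda1_perturbation_quadratic (R : realType) (n : nat) (a : 'rV[R]_n) (r : R)
    (V : 'rV[R]_n -> 'rV[R]_n) : 0 < r -> smooth_field V ->
  (forall x, divergence V x = 0) ->
  exists C : R, exists2 t0 : R, 0 < t0 &
  forall t tau, `|t| <= tau -> 0 < tau -> tau <= t0 ->
  `|lambda1 (perturbation V t @` eball a r) - n%:R / r| <= C * tau ^+ 2.
Proof.
move=> r0 sV divV.
have [L L0 [enormV lipV elipV jacV]] := field_bounds a (r + 3) sV.
exists (n%:R * (8 * (r + 1) / r ^+ 2) * L ^+ 2).
exists (Num.min 2^-1 (r / 8) / L).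
  by rewrite divr_gt0// lt_min invr_gt0 ltr0n divr_gt0.
move=> t tau ttau tau0; rewrite ler_pdivlMr// le_min => /andP[tauL tauLr8].
set Omega := _ @` _.
set k := tau * L in tauL tauLr8.
have k0 : 0 < k by rewrite mulr_gt0.
have k2r : k ^+ 2 <= r / 16 by rewrite expr2; nra.
have k20 : 0 < k ^+ 2 by rewrite exprn_gt0.
(* The width delta is 2 k ^ 2, more than the error k ^ 2 of the inverse S. *)
have ltdelta : k ^+ 2 < 2 * k ^+ 2 by lra.
have deltar : 4 * (2 * k ^+ 2) <= r by lra.
have tauLr : 4 * k <= r by lra.
have [u [g [ug u1 gle]]] := image_upper_bound L0 enormV lipV elipV ttau tauL
  sV divV jacV r0 ltdelta deltar tauLr.
have up := le_trans (lambda1_le ug u1) gle.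
have low : n%:R / (r + k ^+ 2) <= lambda1 Omega.
  apply: lb_le_inf; first by exists (\int[lebesgue_rV R n]_(x in Omega) enorm (g x)), u, g.
  move=> l [u' [g' [ug' u1' ->]]].
  exact: (image_lower_bound L0 enormV elipV ttau tauL sV divV r0 ug' u1').
have -> : n%:R * (8 * (r + 1) / r ^+ 2) * L ^+ 2 * tau ^+ 2 =
    n%:R * (8 * (r + 1) / r ^+ 2 * k ^+ 2).
  by rewrite /k; ring.
set K := k ^+ 2 in up low k2r k20 *; clearbody K.
have n0 : 0 <= n%:R :> R by [].
rewrite ler_norml; apply/andP; split.
  rewrite lerBrDr; apply: le_trans low; rewrite addrC -mulrBr ler_wpM2l// -subr_ge0.
  have -> : (r + K)^-1 - (r^-1 - 8 * (r + 1) / r ^+ 2 * K) =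
      K * (8 * (r + 1) * (r + K) - r) / (r ^+ 2 * (r + K)).
    by field; rewrite !gt_eqF// addr_gt0.
  apply: divr_ge0; last by rewrite mulr_ge0 ?sqr_ge0// addr_ge0// ltW.
  apply: mulr_ge0; first exact: ltW.
  nra.
rewrite lerBlDr; apply: (le_trans up); rewrite mulrC -mulrDr ler_wpM2l// -subr_ge0.
have rK : 0 < r - 4 * K by lra.
have -> : 8 * (r + 1) / r ^+ 2 * K + r^-1 - (1 + 4 * K) / (r - 2 * (2 * K)) =
    4 * K * (r + 1) * (r - 8 * K) / (r ^+ 2 * (r - 4 * K)).
  by field; rewrite !gt_eqF//; lra.
apply: divr_ge0; last by rewrite mulr_ge0 ?sqr_ge0// ltW.
apply: mulr_ge0; last lra.
by rewrite mulr_ge0 ?addr_ge0 ?mulr_ge0// ltW.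
Qed.

Theorem mainTheorem2 (R : realType) (n : nat) (hn : (2 <= n)%N)
    (a : 'rV[R]_n) (r : R) (hr : 0 < r)
    (V : 'rV[R]_n -> 'rV[R]_n) (hV : smooth_field V)
    (hdiv : forall x, divergence V x = 0) :
  let lambda_t := fun t : R => lambda1 (perturbation V t @` eball a r) in
  derivable lambda_t 0 1 /\ derive1 lambda_t 0 = 0.
Proof.
move=> lambda_t.
have [C [t0 t00 HC]] := lambda1_perturbation_quadratic a hr hV hdiv.
have [] : is_derive (0 : R) (1 : R) lambda_t 0.
  apply: (is_derive_quadratic (C := 2 * C) t00) => t tt0.
  have [->|t_neq0] := eqVneq t 0; first by rewrite subrr normr0 expr0n/= mulr0.
  have t_gt0 : 0 < `|t| by rewrite normr_gt0.
  (* Both values are compared with n / r for the same tau = |t|. *)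
  have Ht := HC t `|t| (lexx _) t_gt0 tt0.
  have H0 : `|lambda_t 0 - n%:R / r| <= C * `|t| ^+ 2 by apply: HC => //; rewrite normr0.
  rewrite -real_normK ?num_real//.
  rewrite -[X in X - _](subrK (n%:R / r)) -addrA (le_trans (ler_normD _ _))//.
  have -> : 2 * C * `|t| ^+ 2 = C * `|t| ^+ 2 + C * `|t| ^+ 2 by ring.
  by rewrite [`|n%:R / r - _|]distrC lerD.
by rewrite derive1E.
Qed.
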